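(* Let $\bm{L}\in\mathbb{R}^{m\times n}$ have rank $r$ and compact SVD $\bm{L}=\bm{W}_{\bm{L}}\bm{\Sigma}_{\bm{L}}\bm{V}_{\bm{L}}^T$, and suppose $\max_{i}\|\bm{W}_{\bm{L}}^T\bm{e}_i\|_2\leq\sqrt{\mu_1(\bm{L}) r/m}$ and $\max_{i}\|\bm{V}_{\bm{L}}^T\bm{e}_i\|_2\leq\sqrt{\mu_2(\bm{L}) r/n}$. Suppose $J\subseteq[n]$ is chosen by sampling uniformly without replacement, with $|J|\geq\gamma\mu_2(\bm{L})r$ for some $\gamma>0$, and let $\bm{C}=\bm{L}(:,J)$ with compact SVD $\bm{C}=\bm{W}_{\bm{C}}\bm{\Sigma}_{\bm{C}}\bm{V}_{\bm{C}}^T$. Let $\delta\in[0,1)$. Then with probability at least $1-\frac{r}{e^{\gamma(\delta+(1-\delta)\log(1-\delta))}}$ the quantity $\beta=\sqrt{|J|/n}\,\|(\bm{V}_{\bm{L}}(J,:))^\dagger\|_2$ satisfies \begin{enumerate} \item $\beta\leq\frac{1}{\sqrt{1-\delta}}$, \item $\max_i\|\bm{V}_{\bm{C}}^T\bm{e}_i\|_2\leq\beta\,\kappa(\bm{L})\sqrt{\frac{\mu_2(\bm{L})r}{|J|}}$, and \item $\kappa(\bm{C})\leq\beta\sqrt{\mu_2(\bm{L}) r}\,\kappa(\bm{L})$. \end{enumerate} In particular, with the same probability, $\mu_1(\bm{C})\leq\mu_1(\bm{L})$ and $\mu_2(\bm{C})\leq\beta^2\kappa(\bm{L})^2\mu_2(\bm{L})$,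 i.e. $\max_i\|\bm{W}_{\bm{C}}^T\bm{e}_i\|_2\le\sqrt{\mu_1(\bm{L})r/m}$ and $\max_i\|\bm{V}_{\bm{C}}^T\bm{e}_i\|_2\le\sqrt{\beta^2\kappa(\bm{L})^2\mu_2(\bm{L})r/|J|}$.
   Context: $[n]=\{1,\dots,n\}$; $\bm{A}(I,J)$ denotes a submatrix ('':'' meaning all indices); $\bm{A}^\dagger$ is the Moore–Penrose pseudoinverse; $\kappa(\bm{A})=\sigma_{\max}(\bm{A})/\sigma_{\min}(\bm{A})$ with $\sigma_{\min}$ the smallest nonzero singular value; $\bm{e}_i$ is a canonical basis vector; $\log$ is the natural logarithm. Incoherence parameters $\mu_1(\bm{C}),\mu_2(\bm{C})$ of $\bm{C}\in\mathbb{R}^{m\times|J|}$ are the constants in $\max_i\|\bm{W}_{\bm{C}}^T\bm{e}_i\|_2\le\sqrt{\mu_1(\bm{C})r/m}$ and $\max_i\|\bm{V}_{\bm{C}}^T\bm{e}_i\|_2\le\sqrt{\mu_2(\bm{C})r/|J|}$. *)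

(* Defs.v *)
From HB Require Import structures.
From mathcomp Require Import all_boot all_order all_algebra.
From mathcomp Require Import all_classical all_reals all_analysis.
From Stdlib Require Import ClassicalEpsilon.
Set Implicit Arguments. Unset Strict Implicit. Unset Printing Implicit Defensive.
Import Order.TTheory GRing.Theory Num.Theory.
Local Open Scope ring_scope.
Local Open Scope classical_set_scope.

Section Defs.
Variable R : realType.

Definition vnorm n (v : 'cV[R]_n) : R := Num.sqrt (\sum_i v i 0 ^+ 2).

Definition evec n (i : 'I_n) : 'cV[R]_n := delta_mx i 0.

Definition spec_norm m n (A : 'M[R]_(m, n)) : R :=
  sup [set vnorm (A *m x) | x in [set x : 'cV[R]_n | vnorm x = 1]].

Definition is_mp_pinv m n (A : 'M[R]_(m, n)) (X : 'M[R]_(n, m)) : Prop :=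
  [/\ A *m X *m A = A, X *m A *m X = X,
      (A *m X)^T = A *m X & (X *m A)^T = X *m A].

Definition mp_pinv m n (A : 'M[R]_(m, n)) : 'M[R]_(n, m) :=
  epsilon (inhabits 0) (is_mp_pinv A).

Definition sing_vals m n (A : 'M[R]_(m, n)) : set R :=
  [set s | 0 < s /\ eigenvalue (A^T *m A) (s ^+ 2)].

Definition sigma_max m n (A : 'M[R]_(m, n)) : R := sup (sing_vals A).
Definition sigma_min m n (A : 'M[R]_(m, n)) : R := inf (sing_vals A).
Definition cond_num m n (A : 'M[R]_(m, n)) : R := sigma_max A / sigma_min A.

Definition is_csvd m n s (A : 'M[R]_(m, n)) (W : 'M[R]_(m, s)) (S : 'M[R]_s)
    (V : 'M[R]_(n, s)) : Prop :=
  [/\ W^T *m W = 1%:M, V^T *m V = 1%:M,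
      (forall i j : 'I_s, i != j -> S i j = 0) /\
      (forall i : 'I_s, 0 < S i i),
      (forall i j : 'I_s, (i <= j)%N -> S j j <= S i i)
    & A = W *m S *m V^T].

(* column / row submatrices indexed by a set J (in increasing order) *)
Definition colsubset m n (A : 'M[R]_(m, n)) (J : {set 'I_n}) : 'M[R]_(m, #|J|) :=
  colsub (fun j : 'I_#|J| => enum_val j) A.
Definition rowsubset m n (A : 'M[R]_(m, n)) (J : {set 'I_m}) : 'M[R]_(#|J|, n) :=
  rowsub (fun j : 'I_#|J| => enum_val j) A.

End Defs.

(* Main.v *)
Require Import Defs.
From HB Require Import structures.
From mathcomp Require Import all_boot all_order all_algebra.
From mathcomp Require Import all_classical all_reals all_analysis.
From mathcomp Require Import ring lra.
From Stdlib Require Import ClassicalEpsilon.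
Set Implicit Arguments. Unset Strict Implicit. Unset Printing Implicit Defensive.
Import Order.TTheory GRing.Theory Num.Theory.
Import numFieldNormedType.Exports.
Local Open Scope ring_scope.

(** Let [v_j] be the rows of [V_L], so that [sum_j v_j v_j^T = 1], and let
    [G_J] be the sum of [v_j v_j^T] over [J].  If [G_J >= (1 - delta) |J| / n],
    then [||V_L(J,:)^+||] is at most the inverse square root of that bound, and
    comparing the two factorizations of [C = W_L S_L V_L(J,:)^T] gives all the
    claims on [C].

    The probability that [G_J] has a small eigenvalue is bounded by a matrix
    Chernoff argument for sampling without replacement, with the potential
    [sum_(|J| = t) tr (1 - eps G_J) ^ N] standing for the mean of
    [tr exp (- theta G_J)]; here [eps = theta / (N + theta)] and [N] tends to
    infinity.  Adding one index to [J] is a rank-one update, for which the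
    Golden-Thompson inequality reduces to log-convexity of the moments
    [v^T T^a v] of a positive matrix [T].  The missing indices contribute
    [1 - G_J] in place of the identity; the difference is absorbed by
    Chebyshev's association inequality, which is log-convexity of
    [a |-> sum_(|J| = t) tr (1 - eps G_J) ^ a]. *)

(** * Moments of positive semidefinite matrices *)

Section DotProduct.
Context {R : realType}.

Definition dotv {n} (x y : 'cV[R]_n) : R := (x^T *m y) 0 0.

Lemma dotvE n (x y : 'cV[R]_n) : dotv x y = \sum_i x i 0 * y i 0.
Proof. by rewrite /dotv mxE; apply: eq_bigr => i _; rewrite mxE. Qed.

Lemma dotvC n (x y : 'cV[R]_n) : dotv x y = dotv y x.
Proof. by rewrite !dotvE; apply: eq_bigr => i _; rewrite mulrC. Qed.

Lemma dotvDr n (x y z : 'cV[R]_n) : dotv x (y + z) = dotv x y + dotv x z.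
Proof. by rewrite /dotv mulmxDr mxE. Qed.

Lemma dotvZr n c (x y : 'cV[R]_n) : dotv x (c *: y) = c * dotv x y.
Proof. by rewrite /dotv -scalemxAr mxE. Qed.

Lemma dotvZl n c (x y : 'cV[R]_n) : dotv (c *: x) y = c * dotv x y.
Proof. by rewrite dotvC dotvZr dotvC. Qed.

Lemma dotvBr n (x y z : 'cV[R]_n) : dotv x (y - z) = dotv x y - dotv x z.
Proof. by rewrite -scaleN1r dotvDr dotvZr mulN1r. Qed.

Lemma dotvBl n (x y z : 'cV[R]_n) : dotv (y - z) x = dotv y x - dotv z x.
Proof. by rewrite dotvC dotvBr !(dotvC x). Qed.

Lemma dotv_sumr n (I : Type) (s : seq I) (P : pred I) (x : 'cV[R]_n) F :
  dotv x (\sum_(i <- s | P i) F i) = \sum_(i <- s | P i) dotv x (F i).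
Proof. by rewrite /dotv mulmx_sumr summxE. Qed.

Lemma dotv_mulr m n (A : 'M[R]_(m, n)) x y :
  dotv x (A *m y) = dotv (A^T *m x) y.
Proof. by rewrite /dotv trmx_mul trmxK mulmxA. Qed.

Lemma dotv_mull m n (A : 'M[R]_(m, n)) x y :
  dotv (A *m x) y = dotv x (A^T *m y).
Proof. by rewrite dotvC dotv_mulr dotvC. Qed.

Lemma dotvv_ge0 n (x : 'cV[R]_n) : 0 <= dotv x x.
Proof. by rewrite dotvE; apply: sumr_ge0 => i _; rewrite -expr2 sqr_ge0. Qed.

Lemma dotvv_eq0 n (x : 'cV[R]_n) : (dotv x x == 0) = (x == 0).
Proof.
apply/eqP/eqP => [|->]; last by rewrite /dotv mulmx0 mxE.
rewrite dotvE => /eqP; rewrite psumr_eq0 => [/allP h|i _]; last first.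
  by rewrite -expr2 sqr_ge0.
apply/colP => i; rewrite mxE; apply/eqP.
by have := h i (mem_index_enum _); rewrite mulf_eq0 orbb.
Qed.

Lemma dotvv_gt0 n (x : 'cV[R]_n) : (0 < dotv x x) = (x != 0).
Proof. by rewrite lt_def dotvv_ge0 andbT dotvv_eq0. Qed.

Lemma mulmx_outer n (v x : 'cV[R]_n) : v *m v^T *m x = dotv v x *: v.
Proof.
by apply/colP => i; rewrite -mulmxA [LHS]mxE [RHS]mxE big_ord1 mulrC.
Qed.

Lemma mxtrace_mul_outer n (A : 'M[R]_n) (v : 'cV[R]_n) :
  \tr (A *m (v *m v^T)) = dotv v (A *m v).
Proof. by rewrite mulmxA mxtrace_mulC /mxtrace big_ord1. Qed.

Lemma mxtrace_dotv n (A : 'M[R]_n) :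
  \tr A = \sum_i dotv (evec R i) (A *m evec R i).
Proof.
apply: eq_bigr => i _.
by rewrite /evec -colE /dotv trmx_delta -rowE !mxE.
Qed.

End DotProduct.

(** * Log-convex sequences and their product inequality *)

Section LogConvex.
Context {R : realType}.

(* Sequences of moments of a positive measure supported in [tau, +oo[. *)
Definition log_convex (tau : R) (h : nat -> R) : Prop :=
  (forall a, tau * h a <= h a.+1) /\
  (forall a t, 0 <= h a.+2 - 2 * t * h a.+1 + t ^+ 2 * h a).

Lemma log_convex_sum tau (I : Type) (s : seq I) (P : pred I) (h : I -> nat -> R) :
  (forall i, P i -> log_convex tau (h i)) ->
  log_convex tau (fun a => \sum_(i <- s | P i) h i a).
Proof.
move=> hh; split=> [a|a t].
  by rewrite mulr_sumr; apply: ler_sum => i /hh[].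
rewrite !mulr_sumr -sumrB -big_split /=.
by apply: sumr_ge0 => i /hh[_]; apply.
Qed.

Lemma log_convex_gt0 tau h : 0 < tau -> 0 < h 0%N -> log_convex tau h ->
  forall a, 0 < h a.
Proof.
move=> tau0 h0 [hS _]; elim=> // a IH.
by apply: lt_le_trans (hS a); rewrite mulr_gt0.
Qed.

(** Taking [t = h a.+1 / h a], the minimiser of the quadratic, gives [h a.+1 ^+ 2 <= h a * h a.+2],
    so the ratios of consecutive terms are nondecreasing. Moving one unit at a time from the smaller
    index to the larger one then never decreases the product, until the smaller index reaches 0. *)
Lemma log_convex_mul tau h : 0 < tau -> 0 < h 0%N -> log_convex tau h ->
  forall a b, h a * h b <= h 0%N * h (a + b)%N.
Proof.
move=> tau0 h0 hlc; have hp := log_convex_gt0 tau0 h0 hlc.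
have step a : h a.+1 ^+ 2 <= h a * h a.+2.
  have := hlc.2 a (h a.+1 / h a).
  have ha := hp a; rewrite -(pmulr_rge0 _ ha).
  suff -> : h a * (h a.+2 - 2 * (h a.+1 / h a) * h a.+1 + (h a.+1 / h a) ^+ 2 * h a)
    = h a * h a.+2 - h a.+1 ^+ 2 by rewrite subr_ge0.
  by field; rewrite gt_eqF.
have mono a d : h a.+1 * h (a + d)%N <= h a * h (a + d).+1.
  elim: d => [|d IH]; first by rewrite addn0 mulrC.
  rewrite addnS -(ler_pM2l (hp (a + d)%N)).
  have := step (a + d)%N; rewrite -(ler_pM2l (hp a)).
  have := hp (a + d).+1; nra.
have main a d : h a * h (a + d)%N <= h 0%N * h (a + (a + d))%N.
  elim: a d => [|a IH] d; first by rewrite !add0n.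
  apply: le_trans (_ : h a * h (a.+1 + d).+1 <= _).
    by have := mono a d.+1; rewrite !(addnS, addSn).
  by have := IH d.+2; rewrite !(addnS, addSn).
move=> a b; case: (leqP a b) => [/subnKC <-|/ltnW le_ba]; first exact: main.
by have := main b (a - b)%N; rewrite subnKC // mulrC addnC.
Qed.

End LogConvex.

(** * Powers of positive semidefinite matrices *)

Section PositiveSemidefinite.
Context {R : realType} {n : nat}.
Implicit Types (A B : 'M[R]_n) (x : 'cV[R]_n).

Definition psdmx A : Prop := A^T = A /\ forall x, 0 <= dotv x (A *m x).

Lemma psdmxD A B : psdmx A -> psdmx B -> psdmx (A + B).
Proof.
move=> [sA pA] [sB pB]; split; first by rewrite linearD /= sA sB.
by move=> x; rewrite mulmxDl dotvDr addr_ge0.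
Qed.

Lemma psdmxZ c A : 0 <= c -> psdmx A -> psdmx (c *: A).
Proof.
move=> c0 [sA pA]; split; first by rewrite linearZ /= sA.
by move=> x; rewrite -scalemxAl dotvZr mulr_ge0.
Qed.

Lemma psdmx0 : psdmx (0 : 'M[R]_n).
Proof. by split=> [|x]; rewrite ?trmx0 // mul0mx /dotv mulmx0 mxE. Qed.

Lemma psdmx_sum (I : Type) (s : seq I) (P : pred I) (F : I -> 'M[R]_n) :
  (forall i, P i -> psdmx (F i)) -> psdmx (\sum_(i <- s | P i) F i).
Proof. by move=> h; apply: big_ind => //; [exact: psdmx0 | exact: psdmxD]. Qed.

Lemma psdmx_outer (v : 'cV[R]_n) : psdmx (v *m v^T).
Proof.
split=> [|x]; first by rewrite trmx_mul trmxK.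
by rewrite mulmx_outer dotvZr dotvC -expr2 sqr_ge0.
Qed.

Lemma trmxX A a : A^T = A -> (A ^+ a)^T = A ^+ a.
Proof.
move=> sA; elim: a => [|a IH]; first by rewrite expr0 trmx1.
rewrite [in LHS]exprS exprSr; transitivity ((A ^+ a)^T *m A^T).
  exact: trmx_mul.
by rewrite IH sA.
Qed.

(** The form of [A ^+ a.+2] at [x] is the form of [A ^+ a] at [A *m x], so an induction by steps of
    two avoids any diagonalization. *)
Lemma psdmxX A a : psdmx A -> psdmx (A ^+ a).
Proof.
move=> [sA pA]; split; first exact: trmxX.
elim/ltn_ind: a => -[|[|a]] IH x.
- by rewrite expr0 mul1mx dotvv_ge0.
- by rewrite expr1.
- rewrite exprS exprSr -[A * _]/(A *m (_ *m A)) -!mulmxA dotv_mulr sA.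
  exact: IH.
Qed.

Section Spectrum_bounded_below.
Variables (tau : R) (A : 'M[R]_n).
Hypotheses (tau0 : 0 <= tau) (psdA : psdmx (A - tau%:M)).

(** Writing one factor [A] as [(A - tau%:M) + tau%:M] trades a power of [A] for a power of the
    shifted matrix, with nonnegative coefficients; when no [A] is left, [psdmxX] applies. *)
Lemma psdmx_mulX a k : psdmx (A ^+ a *m (A - tau%:M) ^+ k).
Proof.
elim: a k => [|a IH] k; first by rewrite expr0 mul1mx; apply: psdmxX.
rewrite exprSr -[A ^+ a * A]/(A ^+ a *m A) -mulmxA.
have -> : A *m (A - tau%:M) ^+ k = (A - tau%:M) ^+ k.+1 + tau *: (A - tau%:M) ^+ k.
  by rewrite exprS -[_ * _]/(_ *m _) mulmxBl mul_scalar_mx subrK.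
rewrite mulmxDr -scalemxAr; apply: psdmxD; first exact: IH.
exact: psdmxZ.
Qed.

Lemma psdmx_shiftX a : psdmx (A ^+ a).
Proof. by have := psdmx_mulX a 0; rewrite expr0 mulmx1. Qed.

(** These are the moments of the spectral measure of [A] at [x]. The first condition is positivity
    of [A ^+ a *m (A - tau%:M)]; the quadratic in [t] is the form of [A ^+ a] at
    [A *m x - t *: x]. *)
Lemma log_convex_dotv x : log_convex tau (fun a => dotv x (A ^+ a *m x)).
Proof.
split=> [a|a t].
  have [_ /(_ x)] := psdmx_mulX a 1; rewrite expr1 mulmxBr mulmxBl.
  rewrite mul_mx_scalar -scalemxAl dotvBr dotvZr subr_ge0.
  by rewrite exprSr.
have [sA _] := psdmx_shiftX 1; rewrite expr1 in sA.
have [_ /(_ (A *m x - t *: x))] := psdmx_shiftX a.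
congr (_ <= _).
rewrite mulmxBr dotvBl !dotvBr -!scalemxAr !dotvZl !dotvZr.
rewrite !dotv_mull sA !mulmxA.
have -> : A *m A ^+ a *m A = A ^+ a.+2 by rewrite exprS exprSr mulrA.
have -> : A *m A ^+ a = A ^+ a.+1 by rewrite exprS.
have -> : A ^+ a *m A = A ^+ a.+1 by rewrite exprSr.
ring.
Qed.

Lemma log_convex_mxtrace : log_convex tau (fun a => \tr (A ^+ a)).
Proof.
have [h1 h2] := @log_convex_sum _ tau _ (index_enum 'I_n) predT
  (fun i a => dotv (evec R i) (A ^+ a *m evec R i))
  (fun i _ => log_convex_dotv (evec R i)).
by split=> [a|a t]; rewrite !mxtrace_dotv.
Qed.

End Spectrum_bounded_below.

(** With [P] the orthogonal projection onto the complement of [x], the difference of the two sides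
    is the trace of [P^T *m A *m P]. *)
Lemma dotv_le_mxtrace A x : psdmx A -> dotv x x = 1 -> dotv x (A *m x) <= \tr A.
Proof.
move=> [sA pA] x1; set P : 'M[R]_n := 1%:M - x *m x^T.
have PP : P *m P^T = P.
  rewrite /P linearB /= trmx1 trmx_mul trmxK mulmxBl mul1mx mulmxBr mulmx1.
  by rewrite mulmxA mulmx_outer x1 scale1r subrr subr0.
have : 0 <= \tr (P^T *m A *m P).
  rewrite mxtrace_dotv; apply: sumr_ge0 => i _.
  by rewrite -!mulmxA dotv_mulr trmxK pA.
rewrite -mulmxA mxtrace_mulC -mulmxA PP mulmxBr mulmx1 linearB /=.
by rewrite mxtrace_mul_outer subr_ge0.
Qed.

End PositiveSemidefinite.

(** * Rank-one updates *)

Section RankOneUpdate.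
Context {R : realType}.

Lemma le0_derive_nincr (f df : R -> R) (a b : R) : a <= b ->
  (forall x : R, is_derive x 1 f (df x)) ->
  (forall x : R, a < x < b -> df x <= 0) -> f b <= f a.
Proof.
rewrite le_eqVlt => /orP[/eqP <- //|ab] fd dle.
have [|c + fab] := MVT ab (fun x _ => fd x).
  by apply: derivable_within_continuous => x _; exact: ex_derive.
rewrite in_itv /= => /dle dc.
by rewrite -subr_le0 fab mulr_le0_ge0 // subr_ge0 ltW.
Qed.

Lemma is_derive_expRM (c x : R) :
  is_derive x 1 (fun s => expR (c * s)) (c * expR (c * x)).
Proof.
have h : is_derive x 1 (fun s : R => c * s) c.
  have := is_deriveZ c (@is_derive_id R R x 1).
  by rewrite [c *: 1]mulr1.
have := is_derive1_comp (is_derive_expR (c * x)) h.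
by rewrite mulrC.
Qed.

Context {n : nat}.
Variables (T : 'M[R]_n) (v : 'cV[R]_n).

Definition rank_one_path (s : R) : 'M[R]_n := T - s *: (v *m v^T).

(** The Leibniz formula for the derivative of the [N]-th power of the path, whose factors need not
    commute with [v *m v^T]. The truncation in [N.-1] only occurs when the sum is empty. *)
Definition rank_one_dX (N : nat) (s : R) : 'M[R]_n :=
  - \sum_(a < N) rank_one_path s ^+ a *m (v *m v^T) *m rank_one_path s ^+ (N.-1 - a).

Lemma rank_one_dXS N s : rank_one_dX N.+1 s =
  rank_one_path s *m rank_one_dX N s - (v *m v^T) *m rank_one_path s ^+ N.
Proof.
rewrite /rank_one_dX big_ord_recl expr0 mul1mx subn0 opprD addrC mulmxN; congr (- _ - _).
rewrite mulmx_sumr; apply: eq_bigr => a _.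
rewrite lift0 exprS !mulmxA -[_ * _]/(_ *m _); congr (_ *m _ ^+ _).
by rewrite /=; case: N a => [[]//|N] a; rewrite subSS.
Qed.

Lemma is_derive_rank_one N i j (s : R) :
  is_derive s 1 (fun s => (rank_one_path s ^+ N) i j) (rank_one_dX N s i j).
Proof.
elim: N i j => [|N IH] i j.
  have -> : rank_one_dX 0 s i j = 0 by rewrite /rank_one_dX big_ord0 oppr0 mxE.
  exact: (@is_derive_cst _ _ _ ((1 : 'M[R]_n) i j)).
have dT k : is_derive s 1 (fun s => rank_one_path s i k) (- (v *m v^T) i k).
  have := is_deriveD (@is_derive_cst R R R (T i k) s 1)
    (is_deriveZ (- (v *m v^T) i k) (@is_derive_id R R s 1)).
  rewrite add0r [_ *: 1]mulr1; congr (is_derive _ _ _ _).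
  apply/funext => u; rewrite /rank_one_path [RHS]mxE [X in _ = _ + X]mxE.
  by rewrite [X in _ = _ - X]mxE mulrC -mulNr.
have := is_derive_sum (fun k => is_deriveM (dT k) (IH k j)).
rewrite rank_one_dXS; congr (is_derive _ _ _ _).
- by apply/funext => u; rewrite exprS [RHS]mxE fct_sumE.
- rewrite [RHS]mxE [X in _ = X + _]mxE [X in _ = _ + X]mxE [in RHS]mxE -sumrN -big_split /=.
  by apply: eq_bigr => k _; rewrite scalerN [_ *: _ i k]mulrC.
Qed.

(** Under the trace, cyclicity makes all [N.+1] terms of the Leibniz sum equal. *)
Lemma is_derive_rank_one_mxtrace N (s : R) :
  is_derive s 1 (fun s => \tr (rank_one_path s ^+ N.+1))
    (- N.+1%:R * dotv v (rank_one_path s ^+ N *m v)).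
Proof.
have := is_derive_sum (fun i => is_derive_rank_one N.+1 i i s).
congr (is_derive _ _ _ _); first by apply/funext => u; rewrite fct_sumE.
transitivity (\tr (rank_one_dX N.+1 s)) => //.
rewrite /rank_one_dX raddfN /= mulNr; congr (- _).
rewrite (raddf_sum (@mxtrace R n)) /= mulr_natl -[in RHS](card_ord N.+1) -sumr_const.
apply: eq_bigr => a _; rewrite mxtrace_mulC.
rewrite (mulmxA (rank_one_path s ^+ (N - a))) mxtrace_mul_outer.
have aN : (a <= N)%N by rewrite -ltnS.
by rewrite -[in RHS](subnK aN) exprD.
Qed.

(** The factor [v *m v^T] in the middle of each Leibniz term splits it into a product of two moments
    along [v], to which [log_convex_mul] can be applied. *)
Lemma is_derive_rank_one_dotv N (s : R) :
  is_derive s 1 (fun s => dotv v (rank_one_path s ^+ N *m v))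
    (- \sum_(a < N) dotv v (rank_one_path s ^+ a *m v) *
                    dotv v (rank_one_path s ^+ (N.-1 - a) *m v)).
Proof.
have dotvA (A : 'M[R]_n) :
    dotv v (A *m v) = \sum_i v i 0 * \sum_j v j 0 * A i j.
  rewrite dotvE; apply: eq_bigr => i _; rewrite mxE; congr (_ * _).
  by apply: eq_bigr => j _; rewrite mulrC.
have := is_derive_sum (fun i => is_deriveZ (v i 0)
  (is_derive_sum (fun j => is_deriveZ (v j 0) (is_derive_rank_one N i j s)))).
congr (is_derive _ _ _ _).
  apply/funext => u; rewrite dotvA fct_sumE; apply: eq_bigr => i _.
  by congr (_ * _); rewrite fct_sumE.
rewrite -[LHS]dotvA /rank_one_dX mulNmx mulmx_suml -sumrN dotv_sumr -sumrN.
apply: eq_bigr => a _.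
rewrite -!mulmxA (mulmxA v) mulmx_outer -scalemxAr -scaleNr dotvZr mulNr.
by rewrite mulrC.
Qed.

(* For rank-one perturbations, this is a Golden-Thompson inequality with the
   power [(1 + x / N) ^ N] in place of the exponential.  Log-convexity of the
   moments of [T - s v v^T] along [v] bounds the logarithmic derivative in [s]
   of the rate of decrease of the trace. *)
Lemma mxtrace_rank_one_update (tau eps b : R) N :
  0 < tau -> 0 <= eps -> 0 < b -> dotv v v <= b ->
  psdmx (T - eps *: (v *m v^T) - tau%:M) ->
  \tr ((T - eps *: (v *m v^T)) ^+ N.+1) <= \tr (T ^+ N.+1) -
    (1 - expR (- (N.+1%:R * b * eps / tau))) * tau / b * dotv v (T ^+ N *m v).
Proof.
move=> tau0 eps0 b0 vb psdT.
have T0 : rank_one_path 0 = T by rewrite /rank_one_path scale0r subr0.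
have [v0|vn0] := eqVneq v 0.
  by rewrite v0 mul0mx scaler0 subr0 /dotv trmx0 mul0mx mxE mulr0 subr0.
(* The logarithmic rate of decrease of [h s N] is at most [N%:R * b / tau]; using [N.+1] keeps [K]
   positive for [N = 0], since [c] divides by it. *)
set K := N.+1%:R * b / tau; have K0 : 0 < K by rewrite /K divr_gt0 ?mulr_gt0.
have psdp s : 0 <= s <= eps -> psdmx (rank_one_path s - tau%:M).
  move=> /andP[s0 se].
  have -> : rank_one_path s - tau%:M =
      T - eps *: (v *m v^T) - tau%:M + (eps - s) *: (v *m v^T).
    by rewrite scalerBl addrACA [X in _ = _ + X]addrC addrA addrNK /rank_one_path addrAC.
  by apply: psdmxD => //; apply: psdmxZ; [rewrite subr_ge0|exact: psdmx_outer].
pose h s a := dotv v (rank_one_path s ^+ a *m v).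
have hlc s : 0 <= s <= eps -> log_convex tau (h s).
  by move=> /psdp p; exact: (log_convex_dotv (ltW tau0) p).
have h0 s : h s 0%N = dotv v v by rewrite /h expr0 mul1mx.
have vv0 : 0 < dotv v v by rewrite dotvv_gt0.
have hmul s a c : 0 <= s <= eps -> h s a * h s c <= dotv v v * h s (a + c)%N.
  by move=> /hlc H; rewrite -(h0 s); apply: log_convex_mul tau0 _ H _ _; rewrite h0.
have hpos s a : 0 <= s <= eps -> 0 < h s a.
  by move=> /hlc H; apply: log_convex_gt0 tau0 _ H a; rewrite h0.
(* Log-convexity merges the two moments into the one of order [N.-1], and the spectral lower bound
   [tau] raises that order to [N] at the price of a factor [tau^-1]. *)
have hb s (a : 'I_N) : 0 <= s <= eps -> h s a * h s (N.-1 - a)%N <= b / tau * h s N.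
  move=> sI; apply: le_trans (hmul s _ _ sI) _.
  have -> : (a + (N.-1 - a) = N.-1)%N by case: (N) a => [[]//|M] a; rewrite subnKC // -ltnS.
  rewrite mulrAC ler_pdivlMr // -mulrA.
  apply: ler_pM => //; [exact: ltW|by rewrite mulr_ge0 ?ltW ?hpos|].
  have := (hlc s sI).1 N.-1; rewrite mulrC prednK //.
  by case: (N) a => [[]|].
(* A Gronwall argument: [expR (K * s) * h s N] is nondecreasing in [s]. *)
have gdec s : 0 <= s <= eps -> expR (- K * s) * h 0 N <= h s N.
  move=> sI; rewrite mulNr expRN -ler_pdivlMl ?invr_gt0 ?expR_gt0 // invrK.
  have dG u := is_deriveN (is_deriveM (is_derive_expRM K u) (is_derive_rank_one_dotv N u)).
  have := le0_derive_nincr (andP sI).1 dG.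
  rewrite /= -[(- _) s]/(- (expR (K * s) * h s N)) -[(- _) 0]/(- (expR (K * 0) * h 0 N)).
  rewrite mulr0 expR0 mul1r lerN2; apply => x /andP[x0 xs].
  have xI : 0 <= x <= eps by rewrite ltW //=; apply: le_trans (ltW xs) (andP sI).2.
  set S := \sum_(a < N) _; pose E := expR (K * x).
  change (- (E * - S + h x N * (K * E)) <= 0).
  have E0 : 0 < E := expR_gt0 _.
  suff SK : S <= K * h x N.
    rewrite oppr_le0 (_ : _ + _ = E * (K * h x N - S)); last by ring.
    by rewrite mulr_ge0 ?subr_ge0 // ltW.
  apply: le_trans (_ : \sum_(a < N) (b / tau * h x N) <= _).
    by apply: ler_sum => a _; exact: hb.
  rewrite sumr_const card_ord -[leLHS]mulr_natl mulrA ler_pM2r ?hpos //.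
  by rewrite /K mulrA ler_pM2r ?invr_gt0 // ler_pM2r // ler_nat.
(* With this constant, [c * expR (- K * s)] has derivative [- N.+1%:R * expR (- K * s) * h 0 N],
   which by [gdec] is at least the derivative of the trace; so the trace minus this function is
   nonincreasing. *)
pose c := N.+1%:R / K * h 0 N.
have dF u := is_deriveD (is_derive_rank_one_mxtrace N u)
   (is_deriveZ (- c) (is_derive_expRM (- K) u)).
have := le0_derive_nincr eps0 dF.
rewrite -[(_ + _) eps]/(\tr (rank_one_path eps ^+ N.+1) + - c * expR (- K * eps)).
rewrite -[(_ + _) 0]/(\tr (rank_one_path 0 ^+ N.+1) + - c * expR (- K * 0)).
rewrite T0 mulr0 expR0 mulr1 => H.
have -> : N.+1%:R * b * eps / tau = K * eps by rewrite /K; ring.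
have -> : (1 - expR (- (K * eps))) * tau / b * dotv v (T ^+ N *m v) =
    c - c * expR (- K * eps).
  by rewrite /c /h T0 mulNr /K; field; rewrite !gt_eqF.
suff /H : forall x, 0 < x < eps -> - N.+1%:R * h x N + - c * (- K * expR (- K * x)) <= 0.
  by rewrite /rank_one_path; lra.
move=> x /andP[x0 xe]; have xI : 0 <= x <= eps by rewrite !ltW.
have -> : - N.+1%:R * h x N + - c * (- K * expR (- K * x)) =
    N.+1%:R * (expR (- K * x) * h 0 N - h x N).
  by rewrite /c; field; rewrite gt_eqF.
by rewrite mulr_ge0_le0 // subr_le0 gdec.
Qed.

End RankOneUpdate.

(** * Sampling without replacement *)

Section SubsetSums.
Context {R : realType} {n : nat}.

(** Double counting: a set of size [t.+1] arises by insertion once for each of its elements. *)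
Lemma sum_subsets_setU1 (F : {set 'I_n} -> R) t :
  \sum_(J : {set 'I_n} | #|J| == t) \sum_(j | j \notin J) F (j |: J) =
  t.+1%:R * \sum_(J : {set 'I_n} | #|J| == t.+1) F J.
Proof.
transitivity (\sum_(J : {set 'I_n} | #|J| == t.+1) \sum_(j in J) F J); last first.
  rewrite mulr_sumr; apply: eq_bigr => J /eqP cJ.
  by rewrite sumr_const cJ mulr_natl.
rewrite (exchange_big_dep predT) //= [RHS](exchange_big_dep predT) //=.
apply: eq_bigr => j _.
rewrite [RHS](reindex_onto (fun J => j |: J) (fun J => J :\ j)) /=; last first.
  by move=> J /andP[_ jJ]; rewrite finset.setD1K.
apply: eq_bigl => J; rewrite finset.setU11 andbT.
have [jJ|jJ] /= := boolP (j \in J).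
  rewrite andbF; apply/esym/negP => /andP[_ /eqP/setP/(_ j)].
  by rewrite !inE eqxx jJ.
by rewrite andbT setU1K // eqxx andbT cardsU1 jJ add1n eqSS.
Qed.

Lemma sum_subsets_const (c : R) t :
  \sum_(J : {set 'I_n} | #|J| == t) c = 'C(n, t)%:R * c.
Proof.
rewrite sumr_const -[in RHS](card_ord n) -card_draws mulr_natl; congr (_ *+ _).
by apply: eq_card => J; rewrite inE.
Qed.

(** Each index lies in a fraction [t / n] of the subsets of size [t]. The induction inserts one
    index at a time by means of [sum_subsets_setU1]. *)
Lemma sum_subsets_sum (w : 'I_n -> R) t : (0 < n)%N ->
  \sum_(J : {set 'I_n} | #|J| == t) \sum_(j in J) w j =
  'C(n, t)%:R * (t%:R / n%:R) * \sum_j w j.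
Proof.
move=> n0; have nn0 : n%:R != 0 :> R by rewrite pnatr_eq0 -lt0n.
elim: t => [|t IH].
  rewrite mul0r mulr0 mul0r big1 // => J /eqP/cards0_eq ->.
  by rewrite big_set0.
apply: (@mulfI _ t.+1%:R); first by rewrite pnatr_eq0.
rewrite -sum_subsets_setU1 -!(mulrA 'C(n, t.+1)%:R) (mulrA t.+1%:R) -natrM.
rewrite mul_bin_left natrM.
(* Beyond size [n] there are no subsets and both sides vanish; below, [n - t] is a genuine
   subtraction. *)
have [tn|nt] := leqP t n; last first.
  rewrite bin_small // mulr0 mul0r big1 // => J /eqP cJ.
  by have := max_card (mem J); rewrite cJ card_ord leqNgt nt.
transitivity (\sum_(J : {set 'I_n} | #|J| == t)
   (\sum_j w j + (n%:R - t%:R - 1) * \sum_(j in J) w j)).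
  apply: eq_bigr => J /eqP cJ.
  under eq_bigr => j jJ do rewrite big_setU1 //=.
  rewrite big_split /= [X in _ + X](eq_bigl (mem (~: J))); last first.
    by move=> j; rewrite /= inE.
  rewrite sumr_const cardsCs finset.setCK cJ card_ord -[_ *+ (n - t)]mulr_natl natrB //.
  by rewrite (bigID (mem J) predT) /=; ring.
rewrite big_split /= sum_subsets_const -mulr_sumr IH natrB //.
by rewrite -natr1; field.
Qed.

End SubsetSums.

(** * Passage from powers to exponentials *)

Section ExpLimits.
Context {R : realType}.

(** Let [y] be the base of the power. The shape of the coefficient and [lambda <= 1] give
    [N.+1%:R / (N.+1%:R + theta) <= y], whence [y^-1 <= 1 + theta * lambda / N.+1%:R], and this is
    at most the exponential of its second term. *)
Lemma exp_shrink_le (N : nat) (theta lambda : R) : 0 <= theta -> 0 <= lambda <= 1 ->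
  expR (- (theta * lambda)) <= (1 - theta / (N.+1%:R + theta) * lambda) ^+ N.+1.
Proof.
move=> t0 /andP[l0 l1]; set M := N.+1%:R + theta.
have M0 : 0 < M by rewrite ltr_pwDl.
set y := 1 - _; have yN : N.+1%:R / M <= y.
  have -> : N.+1%:R / M = 1 - theta / M.
    by rewrite -[N.+1%:R](addrK theta) -/M mulrBl divff ?gt_eqF.
  by rewrite lerD2l lerN2 ler_piMr // divr_ge0 // ltW.
have y0 : 0 < y by apply: lt_le_trans yN; rewrite divr_gt0.
rewrite expRN -[leRHS]invrK lef_pV2 ?posrE ?invr_gt0 ?exprn_gt0 ?expR_gt0 //.
rewrite -exprVn.
have -> : theta * lambda = theta * lambda / N.+1%:R * N.+1%:R by rewrite mulfVK.
rewrite mulrC expRM_natl; apply: lerXn2r; rewrite ?nnegrE ?expR_ge0 ?invr_ge0 ?(ltW y0) //.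
apply: le_trans (expR_ge1Dx _).
have -> : y^-1 = 1 + (1 - y) / y by field; rewrite gt_eqF.
rewrite lerD2l ler_pdivrMr //.
have -> : 1 - y = theta * lambda / N.+1%:R * (N.+1%:R / M).
  by rewrite /y; field; rewrite gt_eqF //= pnatr_eq0.
by rewrite ler_wpM2l // divr_ge0 // mulr_ge0.
Qed.

(** Discards the error left by using a finite power, once it is isolated as an exponential factor
    tending to 1. *)
Lemma le_of_le_expR_harmonic (x y z : R) :
  (forall N : nat, x <= y * expR (z / N.+1%:R)) -> x <= y.
Proof.
move=> h.
have c : ((y * expR (z * harmonic N))%R @[N --> \oo] --> (y * expR (z * 0))%R)%classic.
  apply: cvgMl_tmp; apply: continuous_cvg; first exact: continuous_expR.
  by apply: cvgMl_tmp; exact: cvg_harmonic.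
have := limr_ge (x := x) (cvgP _ c).
rewrite (cvg_lim _ c) // mulr0 expR0 mulr1; apply.
by apply: nearW => N; exact: h.
Qed.

End ExpLimits.

(** * The trace potential and the tail bound for the smallest eigenvalue *)

Section Sampling.
Context {R : realType} {n r : nat}.
Variable v : 'I_n -> 'cV[R]_r.

Definition gram (J : {set 'I_n}) : 'M[R]_r := \sum_(j in J) v j *m (v j)^T.

Lemma dotv_gram J x : dotv x (gram J *m x) = \sum_(j in J) dotv (v j) x ^+ 2.
Proof.
rewrite /gram mulmx_suml dotv_sumr; apply: eq_bigr => j _.
by rewrite mulmx_outer dotvZr dotvC expr2.
Qed.

Lemma mxtrace_mul_gram (A : 'M[R]_r) J :
  \tr (A *m gram J) = \sum_(j in J) dotv (v j) (A *m v j).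
Proof.
rewrite /gram mulmx_sumr (raddf_sum (@mxtrace R r)) /=.
by apply: eq_bigr => j _; rewrite mxtrace_mul_outer.
Qed.

Lemma psdmx_gram J : psdmx (gram J).
Proof. by apply: psdmx_sum => j _; exact: psdmx_outer. Qed.

Hypotheses (n0 : (0 < n)%N) (r0 : (0 < r)%N).
Hypothesis frame : gram [set: 'I_n] = 1%:M.

Lemma gramC J : gram (~: J) = 1%:M - gram J.
Proof.
apply/esym/eqP; rewrite subr_eq; apply/eqP; rewrite -frame /gram.
rewrite addrC [LHS](bigID (mem J)) /=.
by congr (_ + _); apply: eq_bigl => j; rewrite !inE.
Qed.

Section Potential.
Variables (eps b : R) (N : nat).
Hypotheses (eps01 : 0 < eps < 1) (b0 : 0 < b).
Hypothesis vb : forall j, dotv (v j) (v j) <= b.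

Let tau : R := 1 - eps.
Let tau0 : 0 < tau. Proof. by rewrite subr_gt0; case/andP: eps01. Qed.
Let eps0 : 0 < eps. Proof. by case/andP: eps01. Qed.

Definition shrink J : 'M[R]_r := 1%:M - eps *: gram J.

(** By the frame identity, the excess over [tau = 1 - eps] is [eps] times the Gram matrix of the
    complementary indices. The positive floor [tau] is what makes the log-convexity lemmas
    available. *)
Lemma psdmx_shrink J : psdmx (shrink J - tau%:M).
Proof.
have -> : shrink J - tau%:M = eps *: gram (~: J).
  rewrite gramC scalerBr /shrink /tau raddfB /= opprB addrC addrA subrK.
  by rewrite scalemx1.
by apply: psdmxZ; [exact: ltW|exact: psdmx_gram].
Qed.

Lemma shrinkU1 (J : {set 'I_n}) j : j \notin J ->
  shrink (j |: J) = shrink J - eps *: (v j *m (v j)^T).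
Proof. by move=> jJ; rewrite /shrink /gram big_setU1 //= scalerDr opprD addrCA addrC. Qed.

(** Since [eps *: gram J = 1%:M - shrink J], a Gram factor under the trace becomes a difference of
    consecutive powers. *)
Lemma mxtrace_shrinkS J a :
  eps * \tr (shrink J ^+ a *m gram J) = \tr (shrink J ^+ a) - \tr (shrink J ^+ a.+1).
Proof.
rewrite exprSr -[_ * shrink J]/(_ *m shrink J) {3}/shrink mulmxBr mulmx1.
by rewrite (raddfB (@mxtrace R r)) /= -scalemxAr mxtraceZ; ring.
Qed.

Definition potential a t : R :=
  \sum_(J : {set 'I_n} | #|J| == t) \tr (shrink J ^+ a).

(** The coefficient of the moment in [mxtrace_rank_one_update]. For
    [eps = theta / (N.+1%:R + theta)] the exponent is exactly [- (theta * b)], and the rate tends to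
    the Chernoff rate [(1 - expR (- (theta * b))) / b] as [N] grows. *)
Definition decay_rate : R := (1 - expR (- (N.+1%:R * b * eps / tau))) * tau / b.

Lemma mxtrace_shrink_ge0 a J : 0 <= \tr (shrink J ^+ a).
Proof.
rewrite mxtrace_dotv; apply: sumr_ge0 => i _.
exact: (psdmx_shiftX (ltW tau0) (psdmx_shrink J) a).2.
Qed.

Lemma potential_ge0 a t : 0 <= potential a t.
Proof. by apply: sumr_ge0 => J _; exact: mxtrace_shrink_ge0. Qed.

Lemma potential_decr a t : potential a.+1 t <= potential a t.
Proof.
apply: ler_sum => J _; rewrite -subr_ge0 -mxtrace_shrinkS mulr_ge0 ?(ltW eps0) //.
rewrite mxtrace_mul_gram; apply: sumr_ge0 => j _.
exact: (psdmx_shiftX (ltW tau0) (psdmx_shrink J) a).2.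
Qed.

Lemma sum_dotv_frame : \sum_j dotv (v j) (v j) = r%:R.
Proof.
rewrite -(mxtrace1 R r) -frame -[gram _]mul1mx mxtrace_mul_gram.
by apply: eq_big => j; rewrite ?inE // mul1mx.
Qed.

Lemma potential0 t : potential 0 t = 'C(n, t)%:R * r%:R.
Proof.
rewrite -sum_subsets_const; apply: eq_bigr => J _.
by rewrite expr0 mxtrace1.
Qed.

Lemma potential1 t : potential 1 t = (1 - eps * (t%:R / n%:R)) * potential 0 t.
Proof.
have -> : potential 1 t = potential 0 t -
    eps * \sum_(J : {set 'I_n} | #|J| == t) \sum_(j in J) dotv (v j) (v j).
  rewrite mulr_sumr -sumrB; apply: eq_bigr => J _.
  have := mxtrace_shrinkS J 0; rewrite mxtrace_mul_gram.
  under eq_bigr => j _ do rewrite expr0 mul1mx.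
  by move=> ->; ring.
by rewrite sum_subsets_sum // sum_dotv_frame potential0; ring.
Qed.

(* Chebyshev's association inequality for the joint law of a random subset and
   a random eigenvalue; this is what makes sampling without replacement no
   worse than sampling with replacement. *)
Lemma potential_ratio a t : (t <= n)%N ->
  (1 - eps * (t%:R / n%:R)) * potential a t <= potential a.+1 t.
Proof.
move=> tn; have p0 : 0 < potential 0 t.
  by rewrite potential0 mulr_gt0 ?ltr0n ?bin_gt0.
have lc : log_convex tau (fun a => potential a t).
  by apply: log_convex_sum => J _; exact: (log_convex_mxtrace (ltW tau0) (psdmx_shrink J)).
have := log_convex_mul tau0 p0 lc 1 a.
by rewrite add1n potential1 -mulrA mulrCA ler_pM2l.
Qed.

(** The rank-one update is summed over all pairs of a set [J] and an index outside it. Double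
    counting turns the updated traces into the left side, and the total gain is [decay_rate] times
    the sum [D] of the moments of the missing indices. *)
Lemma potentialS t : (t < n)%N ->
  t.+1%:R * potential N.+1 t.+1 <=
  (n - t)%:R * (1 - decay_rate / n%:R) * potential N.+1 t.
Proof.
move=> tn; have nr0 : 0 < n%:R :> R by rewrite ltr0n.
have c0 : 0 <= decay_rate.
  rewrite /decay_rate divr_ge0 ?(ltW b0) // mulr_ge0 ?(ltW tau0) // subr_ge0.
  rewrite -expR0 ler_expR oppr_le0 divr_ge0 ?(ltW tau0) //.
  by rewrite mulr_ge0 ?(ltW eps0) // mulr_ge0 ?(ltW b0).
rewrite /potential -sum_subsets_setU1.
set D := \sum_(J : {set 'I_n} | #|J| == t) \sum_(j | j \notin J)
  dotv (v j) (shrink J ^+ N *m v j).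
have DE : eps * D = eps * potential N t - potential N t + potential N.+1 t.
  rewrite /D /potential !mulr_sumr -sumrB -big_split /=; apply: eq_bigr => J _.
  have -> : \sum_(j | j \notin J) dotv (v j) (shrink J ^+ N *m v j) =
      \tr (shrink J ^+ N *m gram (~: J)).
    by rewrite mxtrace_mul_gram; apply: eq_bigl => j; rewrite inE.
  rewrite gramC mulmxBr mulmx1 (raddfB (@mxtrace R r)) /= mulrBr mxtrace_shrinkS.
  ring.
(* By [DE] and [potential_ratio], [eps * D] is at least [eps * (1 - t%:R / n%:R) * potential N t];
   the exponent is then raised to [N.+1] by monotonicity. *)
have Dge : (1 - t%:R / n%:R) * potential N.+1 t <= D.
  rewrite -(ler_pM2l eps0) DE.
  have ratio := potential_ratio N (ltnW tn).
  have q0 : 0 <= 1 - t%:R / n%:R :> R.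
    by rewrite subr_ge0 ler_pdivrMr // mul1r ler_nat ltnW.
  apply: le_trans (_ : eps * ((1 - t%:R / n%:R) * potential N t) <= _).
    by rewrite ler_pM2l // ler_wpM2l // potential_decr.
  move: ratio; set q := t%:R / n%:R; lra.
apply: le_trans (_ : (n - t)%:R * potential N.+1 t - decay_rate * D <= _).
  rewrite /D /potential !mulr_sumr -sumrB; apply: ler_sum => J /eqP cJ.
  have -> : (n - t)%N = #|~: J| by rewrite cardsCs finset.setCK cJ card_ord.
  rewrite mulr_natl -sumr_const mulr_sumr.
  rewrite [X in _ <= X - _](eq_bigl (fun j => j \notin J)); last first.
    by move=> j; rewrite inE.
  rewrite -sumrB; apply: ler_sum => j jJ; rewrite shrinkU1 //.
  apply: mxtrace_rank_one_update => //; first exact: ltW.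
  by rewrite -shrinkU1 //; exact: psdmx_shrink.
have -> : (n - t)%:R * (1 - decay_rate / n%:R) * potential N.+1 t =
    (n - t)%:R * potential N.+1 t - decay_rate * ((1 - t%:R / n%:R) * potential N.+1 t).
  by rewrite natrB ?(ltnW tn) //; field; rewrite gt_eqF.
by rewrite lerD2l lerN2 ler_wpM2l.
Qed.

(** Iterates [potentialS]: the counting factors telescope into the binomial coefficient, and each
    factor [1 - x] is bounded by [expR (- x)]. *)
Lemma potential_le t : (t <= n)%N ->
  potential N.+1 t <= 'C(n, t)%:R * r%:R * expR (- (decay_rate / n%:R) * t%:R).
Proof.
elim: t => [_|t IH tn].
  rewrite mulr0 expR0 mulr1 -potential0.
  elim: N.+1 => // a IH; exact: le_trans (potential_decr _ _) IH.
rewrite -(@ler_pM2l _ t.+1%:R) //; apply: le_trans (potentialS tn) _.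
have -> : expR (- (decay_rate / n%:R) * t.+1%:R) =
    expR (- (decay_rate / n%:R)) * expR (- (decay_rate / n%:R) * t%:R).
  by rewrite -expRD -natr1 mulrDr mulr1 addrC.
have -> (x : R) : t.+1%:R * ('C(n, t.+1)%:R * r%:R * x) =
    (n - t)%:R * ('C(n, t)%:R * r%:R * x).
  by rewrite !mulrA -!natrM mul_bin_left.
apply: le_trans (_ : (n - t)%:R * expR (- (decay_rate / n%:R)) * potential N.+1 t <= _).
  rewrite ler_wpM2r ?potential_ge0 // ler_wpM2l //; exact: expR_ge1Dx.
rewrite -mulrA ler_wpM2l // mulrCA ler_wpM2l ?expR_ge0 //; exact: IH (ltnW tn).
Qed.

(** A smallest eigenvalue below [lambda], expressed by a Rayleigh quotient so that no eigenvector is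
    required. *)
Definition ill_conditioned (lambda : R) k : {set {set 'I_n}} :=
  [set J : {set 'I_n} | (#|J| == k) &&
     `[< exists2 x, dotv x x = 1 & dotv x (gram J *m x) < lambda >]].

(** Markov's inequality for the potential. The unit vector witnessing membership has first moment at
    least [1 - eps * lambda] for [shrink J]; log-convexity raises this to the power [N.+1], and the
    trace dominates the resulting moment. *)
Lemma card_ill_conditioned_potential lambda k : 0 <= lambda <= 1 ->
  #|ill_conditioned lambda k|%:R * (1 - eps * lambda) ^+ N.+1 <= potential N.+1 k.
Proof.
move=> /andP[l0 l1]; rewrite mulr_natl -sumr_const /potential.
rewrite [leRHS](bigID (fun J => J \in ill_conditioned lambda k)) /=.
rewrite -[leLHS]addr0; apply: lerD; last first.
  by apply: sumr_ge0 => J _; exact: mxtrace_shrink_ge0.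
rewrite [leRHS](eq_bigl (mem (ill_conditioned lambda k))); last first.
  by move=> J; rewrite /= !inE andbA andbb.
apply: ler_sum => J; rewrite inE => /andP[_ /asboolP[x x1 xl]].
have psdT := psdmx_shrink J.
apply: le_trans (dotv_le_mxtrace (psdmx_shiftX (ltW tau0) psdT _) x1).
have lc := log_convex_dotv (ltW tau0) psdT x.
have h0 : dotv x (shrink J ^+ 0 *m x) = 1 by rewrite expr0 mul1mx.
have h1 : 1 - eps * lambda <= dotv x (shrink J ^+ 1 *m x).
  rewrite expr1 /shrink mulmxBl mul1mx -scalemxAl dotvBr dotvZr x1 lerD2l lerN2.
  by rewrite ler_pM2l // ltW.
have el0 : 0 <= 1 - eps * lambda.
  by case/andP: eps01 => e0 e1; rewrite subr_ge0 mulr_ile1 // ltW.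
elim: N.+1 => [|a IH]; first by rewrite h0 expr0.
rewrite exprS; apply: le_trans (ler_pM el0 (exprn_ge0 _ el0) h1 IH) _.
have := log_convex_mul tau0 _ lc 1 a; rewrite h0 mul1r add1n; exact.
Qed.

End Potential.

(** The choice [theta = - ln (1 - delta) / b] gives [expR (- (theta * b)) = 1 - delta], so the
    limiting decay rate is [delta / b]. Adding the Markov cost [theta * lambda] to the decay
    exponent yields [- (k%:R / (n%:R * b) * E)]. *)
Lemma card_ill_conditioned (b delta gamma : R) k :
  0 < b -> (forall j, dotv (v j) (v j) <= b) -> 0 < delta < 1 -> (k <= n)%N ->
  gamma * (n%:R * b) <= k%:R ->
  #|ill_conditioned ((1 - delta) * (k%:R / n%:R)) k|%:R <=
  'C(n, k)%:R * r%:R * expR (- (gamma * (delta + (1 - delta) * ln (1 - delta)))).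
Proof.
move=> b0 vb /andP[d0 d1] kn gk.
have nr0 : 0 < n%:R :> R by rewrite ltr0n.
set lambda := (1 - delta) * (k%:R / n%:R); set E := delta + (1 - delta) * ln (1 - delta).
have d10 : 0 < 1 - delta by rewrite subr_gt0.
have q0 : 0 <= k%:R / n%:R :> R by rewrite divr_ge0.
have q1 : k%:R / n%:R <= 1 :> R by rewrite ler_pdivrMr // mul1r ler_nat.
have l01 : 0 <= lambda <= 1.
  by rewrite /lambda mulr_ge0 ?(ltW d10) //= mulr_ile1 // ?(ltW d10) // gerBl ltW.
set theta := - ln (1 - delta) / b.
have th0 : 0 < theta.
  by rewrite /theta divr_gt0 // oppr_gt0 ln_lt0 // d10 gtrBl.
(* Nonnegativity lets [gamma] replace the larger [k%:R / (n%:R * b)]. It follows from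
   [1 + u <= expR u] at [u = - ln (1 - delta)], after division by [1 - delta]. *)
have E0 : 0 <= E.
  have := expR_ge1Dx (- ln (1 - delta)); rewrite expRN lnK ?posrE // => h.
  rewrite -(pmulr_lge0 _ (_ : 0 < (1 - delta)^-1)) ?invr_gt0 // /E mulrDl mulrAC.
  rewrite divff ?gt_eqF // mul1r.
  have dV : (1 - delta)^-1 = 1 + delta / (1 - delta) by field; rewrite gt_eqF.
  by rewrite {}dV in h; move: h; lra.
apply: le_trans (_ : 'C(n, k)%:R * r%:R * expR (- (k%:R / (n%:R * b) * E)) <= _); last first.
  rewrite ler_wpM2l ?mulr_ge0 // ler_expR lerN2 ler_wpM2r //.
  by rewrite ler_pdivlMr // mulr_gt0.
(* At finite [N] the rate falls short of its limit by the factor [1 - eps]; since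
   [eps <= theta / N.+1%:R], this shortfall is absorbed by the harmonic error term. *)
apply: (@le_of_le_expR_harmonic _ _ _ (delta / b * (k%:R / n%:R) * theta)) => N.
set eps := theta / (N.+1%:R + theta).
have M0 : 0 < N.+1%:R + theta by rewrite ltr_pwDl // ltW.
have eps01 : 0 < eps < 1 by rewrite /eps divr_gt0 //= ltr_pdivrMr // mul1r ltrDr.
have epsN : eps <= theta / N.+1%:R.
  by rewrite /eps ler_pM2l // lef_pV2 ?posrE // lerDl ltW.
have cE : decay_rate eps b N = delta / b * (1 - eps).
  rewrite /decay_rate.
  have -> : - (N.+1%:R * b * eps / (1 - eps)) = ln (1 - delta).
    have e1 : 1 - eps = N.+1%:R / (N.+1%:R + theta).
      rewrite /eps -[X in _ = X / _](addrK theta) mulrBl divff ?gt_eqF //.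
    have aux (x y : R) : x != 0 -> y != 0 -> x * b * (theta / y) / (x / y) = theta * b.
      by move=> x0 y0; field; rewrite x0 y0.
    rewrite e1 /eps aux ?gt_eqF //.
    by rewrite /theta divfK ?gt_eqF // opprK.
  by rewrite lnK ?posrE //; field; rewrite gt_eqF.
have := card_ill_conditioned_potential N eps01 k l01.
have := @potential_le eps b N eps01 b0 vb k kn.
move=> h1 h2; have := le_trans h2 h1; rewrite cE.
have := exp_shrink_le N (ltW th0) l01; rewrite -/eps => h3 h4.
have {h4} := le_trans (ler_wpM2l (ler0n _ _) h3) h4.
rewrite expRN ler_pdivrMr ?expR_gt0 // => /le_trans; apply; rewrite -[leLHS]mulrA -expRD.
rewrite -[leRHS]mulrA ler_wpM2l ?mulr_ge0 // -expRD ler_expR.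
have -> : theta * lambda = - (k%:R / n%:R) / b * ((1 - delta) * ln (1 - delta)).
  by rewrite /theta /lambda; field; rewrite !gt_eqF.
have -> : k%:R / (n%:R * b) * E = k%:R / n%:R / b * E by field; rewrite !gt_eqF.
rewrite -subr_ge0.
set q := k%:R / n%:R in q0 q1 *; have -> : - (delta / b * (1 - eps) / n%:R) * k%:R =
    - (delta / b * (1 - eps)) * q by rewrite /q; field; rewrite !gt_eqF.
set X := (X in 0 <= X); have -> : X = delta / b * q * (theta / N.+1%:R - eps).
  by rewrite /X /E; ring.
by rewrite mulr_ge0 ?subr_ge0 // mulr_ge0 // divr_ge0 ?ltW.
Qed.

End Sampling.

(** * Norms and pseudoinverses *)

Section EuclideanNorm.
Context {R : realType}.

Lemma vnormE n (x : 'cV[R]_n) : vnorm x = Num.sqrt (dotv x x).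
Proof. by rewrite /vnorm dotvE; congr Num.sqrt; apply: eq_bigr => i _; rewrite expr2. Qed.

Lemma vnorm_ge0 n (x : 'cV[R]_n) : 0 <= vnorm x.
Proof. exact: sqrtr_ge0. Qed.

Lemma sqr_vnorm n (x : 'cV[R]_n) : vnorm x ^+ 2 = dotv x x.
Proof. by rewrite vnormE sqr_sqrtr // dotvv_ge0. Qed.

Lemma ler_vnorm m n (x : 'cV[R]_m) (y : 'cV[R]_n) :
  (vnorm x <= vnorm y) = (dotv x x <= dotv y y).
Proof. by rewrite -!sqr_vnorm ler_sqr ?nnegrE ?vnorm_ge0. Qed.

Lemma vnormZ n c (x : 'cV[R]_n) : vnorm (c *: x) = `|c| * vnorm x.
Proof. by rewrite !vnormE dotvZl dotvZr mulrA -expr2 sqrtrM ?sqr_ge0 // sqrtr_sqr. Qed.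

Lemma vnorm_gt0 n (x : 'cV[R]_n) : (0 < vnorm x) = (x != 0).
Proof. by rewrite vnormE sqrtr_gt0 dotvv_gt0. Qed.

Lemma vnorm0 n : vnorm (0 : 'cV[R]_n) = 0.
Proof. by rewrite vnormE /dotv mulmx0 mxE sqrtr0. Qed.

Lemma vnorm_evec n (i : 'I_n) : vnorm (evec R i) = 1.
Proof.
by rewrite vnormE /dotv /evec trmx_delta mul_delta_mx_cond eqxx mulr1n mxE !eqxx sqrtr1.
Qed.

Lemma dotv_CauchySchwarz n (x y : 'cV[R]_n) :
  dotv x y ^+ 2 <= dotv x x * dotv y y.
Proof.
have [->|x0] := eqVneq x 0; first by rewrite /dotv trmx0 !mul0mx !mxE expr0n mul0r.
have xx : 0 < dotv x x by rewrite dotvv_gt0.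
have := dotvv_ge0 (dotv x x *: y - dotv x y *: x).
rewrite dotvBl !dotvBr !dotvZl !dotvZr (dotvC y x) => h.
rewrite -subr_ge0 -(pmulr_rge0 _ xx); apply: le_trans h _.
by rewrite le_eqVlt; apply/orP; left; apply/eqP; ring.
Qed.

Section Isometry.
Context {p q : nat}.
Variable (Q : 'M[R]_(p, q)).
Hypothesis QQ : Q^T *m Q = 1%:M.

Lemma vnorm_isometry x : vnorm (Q *m x) = vnorm x.
Proof. by rewrite !vnormE dotv_mull mulmxA QQ mul1mx. Qed.

Lemma vnorm_trmx_isometry y : vnorm (Q^T *m y) <= vnorm y.
Proof.
rewrite ler_vnorm; set z := Q^T *m y.
have yz : dotv y (Q *m z) = dotv z z by rewrite dotv_mulr.
have zz : dotv (Q *m z) (Q *m z) = dotv z z by rewrite dotv_mull mulmxA QQ mul1mx.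
have := dotvv_ge0 (y - Q *m z).
by rewrite dotvBl !dotvBr (dotvC _ y) yz zz; lra.
Qed.

End Isometry.

Lemma vnorm_orth_proj n (P : 'M[R]_n) y : P^T = P -> P *m P = P ->
  vnorm (P *m y) <= vnorm y.
Proof.
move=> sP PP; rewrite ler_vnorm.
have := dotvv_ge0 (y - P *m y).
rewrite dotvBl !dotvBr !dotv_mull sP mulmxA PP; lra.
Qed.

Lemma mulmx_diagE n (D : 'M[R]_n) (x : 'cV[R]_n) i :
  (forall i j, i != j -> D i j = 0) -> (D *m x) i 0 = D i i * x i 0.
Proof.
move=> D0; rewrite mxE (bigD1 i) //= big1 ?addr0 // => j ji.
by rewrite D0 1?eq_sym // mul0r.
Qed.

Lemma vnorm_le_entries n (x y : 'cV[R]_n) : (forall i, `|x i 0| <= `|y i 0|) ->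
  vnorm x <= vnorm y.
Proof.
move=> h; rewrite ler_vnorm !dotvE; apply: ler_sum => i _.
rewrite -!expr2 -[x i 0 ^+ 2]real_normK ?num_real // -[y i 0 ^+ 2]real_normK ?num_real //.
by rewrite lerXn2r ?nnegrE.
Qed.

Lemma vnorm_diag_le n (D : 'M[R]_n) u x : (forall i j, i != j -> D i j = 0) ->
  (forall i, 0 < D i i <= u) -> 0 <= u -> vnorm (D *m x) <= u * vnorm x.
Proof.
move=> D0 Du u0; rewrite -[u]ger0_norm // -vnormZ.
apply: vnorm_le_entries => i; rewrite mulmx_diagE // mxE !normrM.
by case/andP: (Du i) => d0 du; rewrite ler_wpM2r // !ger0_norm // ltW.
Qed.

Lemma vnorm_diag_ge n (D : 'M[R]_n) l x : (forall i j, i != j -> D i j = 0) ->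
  0 <= l -> (forall i, l <= D i i) -> l * vnorm x <= vnorm (D *m x).
Proof.
move=> D0 l0 Dl; rewrite -[l in leLHS]ger0_norm // -vnormZ.
apply: vnorm_le_entries => i; rewrite mulmx_diagE // mxE !normrM.
by rewrite ler_wpM2r // !ger0_norm // (le_trans l0).
Qed.

End EuclideanNorm.

(** * Spectral norms and pseudoinverses of matrices with full column rank *)

Section SpectralNorm.
Context {R : realType}.
Local Open Scope classical_set_scope.

Lemma spec_norm_le p q (X : 'M[R]_(p, q)) c : 0 <= c ->
  (forall y, vnorm (X *m y) <= c * vnorm y) -> spec_norm X <= c.
Proof.
move=> c0 Xc; rewrite /spec_norm; set E := image _ _.
(* There are no unit vectors in dimension 0, where the supremum takes its default value 0. *)
have [E0|/set0P/negP/negPn/eqP ->] := pselect (E !=set0); last by rewrite sup0.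
by apply: ge_sup => // _ [y /= y1 <-]; have := Xc y; rewrite y1 mulr1.
Qed.

(** The a priori bound [c] makes the supremum a true upper bound; its value does not enter the
    conclusion. *)
Lemma vnorm_mulmx_le p q (X : 'M[R]_(p, q)) c y :
  (forall y, vnorm (X *m y) <= c * vnorm y) ->
  vnorm (X *m y) <= spec_norm X * vnorm y.
Proof.
move=> Xc; have [->|y0] := eqVneq y 0; first by rewrite mulmx0 !vnorm0 mulr0.
have ny : 0 < vnorm y by rewrite vnorm_gt0.
rewrite -ler_pdivrMr //.
have -> : vnorm (X *m y) / vnorm y = vnorm (X *m ((vnorm y)^-1 *: y)).
  by rewrite -scalemxAr vnormZ ger0_norm ?invr_ge0 ?vnorm_ge0 // mulrC.
apply: ub_le_sup.
  by exists c => _ [z /= z1 <-]; have := Xc z; rewrite z1 mulr1.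
exists ((vnorm y)^-1 *: y) => //=.
by rewrite vnormZ ger0_norm ?invr_ge0 ?vnorm_ge0 // mulVf // gt_eqF.
Qed.

Lemma spec_norm_ge0 p q (X : 'M[R]_(p, q)) : 0 <= spec_norm X.
Proof.
rewrite /spec_norm; set E := image _ _.
have [[E0 Eb]|/sup_out -> //] := pselect (has_sup E).
have [_ [y y1 _]] := E0.
by apply: le_trans (vnorm_ge0 (X *m y)) _; apply: ub_le_sup => //; exists y.
Qed.

Section Pinv.
Context {q r : nat}.
Variables (A : 'M[R]_(q, r)) (lambda : R).
Hypotheses (l0 : 0 < lambda) (Al : forall x, lambda * dotv x x <= dotv (A *m x) (A *m x)).

Lemma gram_unitmx : A^T *m A \in unitmx.
Proof.
rewrite -row_free_unit; apply: inj_row_free => u uA.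
suff : u^T == 0 by rewrite trmx_eq0 => /eqP.
rewrite -dotvv_eq0 eq_le dotvv_ge0 andbT -(pmulr_rle0 _ l0).
apply: le_trans (Al _) _; rewrite dotv_mull mulmxA.
by rewrite /dotv trmxK mulmxA uA mul0mx mxE.
Qed.

Lemma mp_pinvP : is_mp_pinv A (mp_pinv A).
Proof.
(* The lower bound [Al] makes [A] injective, so [A^T *m A] is invertible and the left inverse built
   from it satisfies the four Penrose equations. *)
apply: epsilon_spec; exists (invmx (A^T *m A) *m A^T).
have XA : invmx (A^T *m A) *m A^T *m A = 1%:M by rewrite -mulmxA mulVmx ?gram_unitmx.
split.
- by rewrite -mulmxA XA mulmx1.
- by rewrite XA mul1mx.
- by rewrite !trmx_mul trmxK trmx_inv trmx_mul trmxK mulmxA.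
- by rewrite XA trmx1.
Qed.

Lemma mp_pinvK : mp_pinv A *m A = 1%:M.
Proof.
have [AXA _ _ _] := mp_pinvP.
have : (A^T *m A) *m (mp_pinv A *m A) = A^T *m A by rewrite -mulmxA (mulmxA A) AXA.
by move=> /(congr1 (mulmx (invmx (A^T *m A)))); rewrite mulKmx ?mulVmx ?gram_unitmx.
Qed.

(** By the Penrose equations [A *m mp_pinv A] is an orthogonal projection, hence a contraction,
    while [Al] bounds [A] from below on the vector [mp_pinv A *m y]. *)
Lemma vnorm_mp_pinv y : vnorm (mp_pinv A *m y) <= (Num.sqrt lambda)^-1 * vnorm y.
Proof.
have [_ XAX sAX _] := mp_pinvP.
rewrite ler_pdivlMl ?sqrtr_gt0 //.
apply: le_trans (vnorm_orth_proj y sAX _); last first.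
  by rewrite mulmxA -(mulmxA A) -(mulmxA A) XAX.
rewrite -mulmxA vnormE -sqrtrM ?(ltW l0) // vnormE ler_sqrt ?dotvv_ge0 //.
Qed.

Lemma spec_norm_mp_pinv : spec_norm (mp_pinv A) <= (Num.sqrt lambda)^-1.
Proof. by apply: spec_norm_le vnorm_mp_pinv; rewrite invr_ge0 sqrtr_ge0. Qed.

Lemma vnorm_le_mp_pinv x : vnorm x <= spec_norm (mp_pinv A) * vnorm (A *m x).
Proof.
have := vnorm_mulmx_le (A *m x) vnorm_mp_pinv.
by rewrite mulmxA mp_pinvK mul1mx.
Qed.

End Pinv.
End SpectralNorm.

(** * Compact singular value decompositions *)

Section SingularValues.
Context {R : realType}.
Local Open Scope classical_set_scope.

Lemma csvd_sym m n s (A : 'M[R]_(m, n)) (W : 'M[R]_(m, s)) (S : 'M[R]_s)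
    (V : 'M[R]_(n, s)) : is_csvd A W S V -> S^T = S.
Proof.
move=> [_ _ [S0 _] _ _]; apply/matrixP => i j; rewrite mxE.
by have [->//|ij] := eqVneq i j; rewrite !S0 // eq_sym.
Qed.

(** A row eigenvector [u] of [A^T *m A] gives [w = u *m V] with [w *m S *m S = t ^+ 2 *: w], nonzero
    because [t] is; any nonzero entry of [w] picks out the diagonal entry equal to [t]. Conversely,
    the rows of [V^T] are eigenvectors. *)
Lemma csvd_sing_vals m n s (A : 'M[R]_(m, n)) (W : 'M[R]_(m, s)) (S : 'M[R]_s)
    (V : 'M[R]_(n, s)) :
  is_csvd A W S V -> sing_vals A = [set S i i | i in setT].
Proof.
move=> csvd; have ST := csvd_sym csvd; case: csvd => WW VV [S0 Spos] _ ->.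
have AA : (W *m S *m V^T)^T *m (W *m S *m V^T) = V *m S *m S *m V^T.
  by rewrite !trmx_mul trmxK ST !mulmxA -(mulmxA _ W^T W) WW mulmx1.
have rowS (w : 'rV[R]_s) i : (w *m S) 0 i = w 0 i * S i i.
  by rewrite mxE (bigD1 i) //= big1 ?addr0 // => j ji; rewrite S0 ?mulr0.
apply/seteqP; split=> [t [t0 /eigenvalueP[u]]|_ [i _ <-]].
  rewrite AA !mulmxA => uA u0; set w := u *m V in uA.
  have wE : w *m S *m S = t ^+ 2 *: w.
    have := congr1 (mulmx^~ V) uA.
    by rewrite /= -(mulmxA _ V^T V) VV mulmx1 -scalemxAl.
  have /rV0Pn[i wi] : w != 0.
    apply: contraNneq u0 => w0; move: uA; rewrite w0 !mul0mx => /esym/eqP.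
    by rewrite scaler_eq0 expf_eq0 /= gt_eqF.
  exists i => //.
  have := congr1 (fun z : 'rV[R]_s => z 0 i) wE; rewrite /= !rowS [RHS]mxE.
  rewrite -mulrA -expr2 [LHS]mulrC => e.
  by have /eqP := mulIf wi e; rewrite eqrXn2 ?(ltW t0) ?(ltW (Spos _)) // => /eqP.
split=> //; apply/eigenvalueP; exists (row i V^T); last first.
  apply/eqP => /(congr1 (fun z => (z *m V) 0 i)).
  by rewrite -row_mul VV mul0mx !mxE eqxx => /eqP; rewrite oner_eq0.
have dS : delta_mx 0 i *m S = S i i *: delta_mx 0 i :> 'rV[R]_s.
  apply/rowP => j; rewrite rowS !mxE eqxx /=.
  by have [->|_] := eqVneq j i; rewrite ?mulr0 ?mul0r // mulrC.
rewrite rowE AA !mulmxA -(mulmxA _ V^T V) VV mulmx1 dS -scalemxAl dS.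
by rewrite scalerA -expr2 -scalemxAl.
Qed.

Lemma csvd_cond_num m n s (A : 'M[R]_(m, n)) (W : 'M[R]_(m, s.+1)) (S : 'M[R]_s.+1)
    (V : 'M[R]_(n, s.+1)) :
  is_csvd A W S V -> cond_num A = S ord0 ord0 / S ord_max ord_max.
Proof.
move=> csvd; have sv := csvd_sing_vals csvd; have [_ _ _ Sle _] := csvd.
rewrite /cond_num /sigma_max /sigma_min sv; congr (_ / _).
  apply/eqP; rewrite eq_le; apply/andP; split.
    by apply: ge_sup => [|_ [i _ <-]]; [exists (S ord0 ord0); exists ord0|exact: Sle].
  apply: ub_le_sup; last by exists ord0.
  by exists (S ord0 ord0) => _ [i _ <-]; exact: Sle.
apply/eqP; rewrite eq_le; apply/andP; split.
  apply: ge_inf; last by exists ord_max.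
  by exists (S ord_max ord_max) => _ [i _ <-]; apply: Sle; exact: leq_ord.
apply: lb_le_inf => [|_ [i _ <-]]; first by exists (S ord0 ord0); exists ord0.
by apply: Sle; exact: leq_ord.
Qed.

Lemma csvd0_cond_num m n (A : 'M[R]_(m, n)) (W : 'M[R]_(m, 0)) S (V : 'M[R]_(n, 0)) :
  is_csvd A W S V -> cond_num A = 0.
Proof.
move=> /csvd_sing_vals sv; rewrite /cond_num /sigma_max sv.
have -> : [set S i i | i in setT] = set0 :> set R by apply/seteqP; split=> x // [[]].
by rewrite sup0 mul0r.
Qed.

Lemma csvd_unitmx m n s (A : 'M[R]_(m, n)) (W : 'M[R]_(m, s)) (S : 'M[R]_s)
    (V : 'M[R]_(n, s)) : is_csvd A W S V -> S \in unitmx.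
Proof.
move=> [_ _ [S0 Spos] _ _]; rewrite unitmxE det_trig; last first.
  by apply/is_trig_mxP => i j ij; apply: S0; rewrite neq_ltn ij.
by rewrite unitfE prodf_seq_neq0; apply/allP => i _; rewrite /= gt_eqF.
Qed.

(** * Singular values and singular vectors of a column submatrix *)

Section ColumnSubmatrix.
Context {m n q r s : nat}.
Variables (L : 'M[R]_(m, n)) (W : 'M[R]_(m, r)) (S : 'M[R]_r) (V : 'M[R]_(n, r)).
Variables (U : 'M[R]_(q, r)).
Variables (WC : 'M[R]_(m, s)) (SC : 'M[R]_s) (VC : 'M[R]_(q, s)).
Hypothesis csvdL : is_csvd L W S V.
Hypothesis csvdC : is_csvd (W *m S *m U^T) WC SC VC.

(* The column space of [C] lies in that of [L]; [Q] expresses the left singular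
   vectors of [C] in terms of those of [L]. *)
Lemma csvd_factor : exists Q : 'M[R]_(r, s),
  [/\ Q^T *m Q = 1%:M, WC = W *m Q & VC *m SC = U *m S *m Q].
Proof.
have [WW _ _ _ _] := csvdL; have [WCWC VCVC _ _ CE] := csvdC.
(* The witness comes from solving the equality of the two factorizations of [C] for [WC]. *)
exists (S *m U^T *m VC *m invmx SC).
have WQ : WC = W *m (S *m U^T *m VC *m invmx SC).
  by rewrite !mulmxA CE -(mulmxA _ VC^T) VCVC mulmx1 mulmxK // (csvd_unitmx csvdC).
split=> //; move: (S *m _ *m _ *m _) WQ => Q WQ.
  by rewrite -WCWC WQ trmx_mul -mulmxA (mulmxA W^T) WW mul1mx.
have CW : (W *m S *m U^T)^T *m WC = VC *m SC.
  by rewrite [W *m _ *m _]CE !trmx_mul trmxK (csvd_sym csvdC) -!mulmxA WCWC mulmx1.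
by rewrite -CW WQ !trmx_mul trmxK (csvd_sym csvdL) -!mulmxA (mulmxA W^T) WW mul1mx.
Qed.

Lemma csvd_sub_left_vnorm e : vnorm (WC^T *m e) <= vnorm (W^T *m e).
Proof.
have [Q [QQ -> _]] := csvd_factor.
by rewrite trmx_mul -mulmxA; exact: vnorm_trmx_isometry.
Qed.


End ColumnSubmatrix.

Section ColumnSubmatrixConditioning.
Context {m n q r s : nat}.
Variables (L : 'M[R]_(m, n)).
Variables (W : 'M[R]_(m, r.+1)) (S : 'M[R]_r.+1) (V : 'M[R]_(n, r.+1)).
Variables (U : 'M[R]_(q, r.+1)) (p : R).
Variables (WC : 'M[R]_(m, s.+1)) (SC : 'M[R]_s.+1) (VC : 'M[R]_(q, s.+1)).
Hypothesis csvdL : is_csvd L W S V.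
Hypothesis csvdC : is_csvd (W *m S *m U^T) WC SC VC.
Hypothesis Up : forall x, vnorm x <= p * vnorm (U *m x).

Let Smax := S ord0 ord0.
Let Smin := S ord_max ord_max.

Let Smax_gt0 : 0 < Smax. Proof. by have [_ _ [_ +] _ _] := csvdL; apply. Qed.
Let Smin_gt0 : 0 < Smin. Proof. by have [_ _ [_ +] _ _] := csvdL; apply. Qed.

Let vnorm_S_le (x : 'cV[R]_r.+1) : vnorm (S *m x) <= Smax * vnorm x.
Proof.
have [_ _ [S0 Spos] Sle _] := csvdL.
by apply: vnorm_diag_le => // [i|]; [rewrite Spos Sle|exact: ltW].
Qed.

Let vnorm_S_ge (x : 'cV[R]_r.+1) : Smin * vnorm x <= vnorm (S *m x).
Proof.
have [_ _ [S0 Spos] Sle _] := csvdL.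
by apply: vnorm_diag_ge => // [|i]; [exact: ltW|apply: Sle; exact: leq_ord].
Qed.

(** As [VC] is an isometry, a singular value of [C] is the length of a column of [VC *m SC]. The
    factorization through [Q] then lets bounds on [U] and [S] pass to [SC]. *)
Let vnorm_SC (Q : 'M[R]_(r.+1, s.+1)) i :
  VC *m SC = U *m S *m Q -> SC i i = vnorm (U *m (S *m (Q *m evec R i))).
Proof.
have [_ VV [SC0 SCpos] _ _] := csvdC => VQ.
rewrite !mulmxA -VQ -mulmxA vnorm_isometry //.
have -> : SC *m evec R i = SC i i *: evec R i.
  apply/colP => j; rewrite mulmx_diagE // !mxE eqxx andbT.
  by have [->|_] := eqVneq j i; rewrite ?mulr0.
by rewrite vnormZ vnorm_evec mulr1 gtr0_norm.
Qed.

Lemma csvd_sub_sing_val_ge i : Smin <= p * SC i i.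
Proof.
have [Q [QQ _ VQ]] := csvd_factor csvdL csvdC.
rewrite (vnorm_SC i VQ); apply: le_trans (Up _); apply: le_trans (vnorm_S_ge _).
by rewrite vnorm_isometry // vnorm_evec mulr1.
Qed.

Lemma csvd_sub_sing_val_le f i : 0 <= f -> (forall x, vnorm (U *m x) <= f * vnorm x) ->
  SC i i <= f * Smax.
Proof.
move=> f0 Uf; have [Q [QQ _ VQ]] := csvd_factor csvdL csvdC.
rewrite (vnorm_SC i VQ); apply: le_trans (Uf _) _; rewrite ler_wpM2l //.
by apply: le_trans (vnorm_S_le _) _ => //; rewrite vnorm_isometry // vnorm_evec mulr1.
Qed.

(** Transposing the factorization gives [SC *m VC^T = Q^T *m S *m U^T]. Its left side expands by at
    least the smallest entry of [SC], which is at least [Smin / p] in effect, and on the right [Q^T]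
    contracts and [S] expands by at most [Smax]. *)
Lemma csvd_sub_right_vnorm e : 0 <= p ->
  vnorm (VC^T *m e) <= p * cond_num L * vnorm (U^T *m e).
Proof.
move=> p0; have [Q [QQ _ VQ]] := csvd_factor csvdL csvdC.
rewrite (csvd_cond_num csvdL) -/Smax -/Smin mulrA mulrAC ler_pdivlMr //.
have [_ _ [SC0 SCpos] SCle _] := csvdC.
apply: le_trans (_ : p * SC ord_max ord_max * vnorm (VC^T *m e) <= _).
  by rewrite mulrC ler_wpM2r ?vnorm_ge0 ?csvd_sub_sing_val_ge.
rewrite -!mulrA ler_wpM2l //.
apply: le_trans (_ : vnorm (SC *m (VC^T *m e)) <= _).
  by apply: vnorm_diag_ge => // [|i]; [exact: ltW|apply: SCle; exact: leq_ord].
have -> : SC *m (VC^T *m e) = Q^T *m (S *m (U^T *m e)).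
  have := congr1 trmx VQ; rewrite !trmx_mul (csvd_sym csvdL) (csvd_sym csvdC).
  by rewrite !mulmxA => ->.
exact: le_trans (vnorm_trmx_isometry QQ _) (vnorm_S_le _).
Qed.

Lemma csvd_sub_cond_num f : 0 <= f -> (forall x, vnorm (U *m x) <= f * vnorm x) ->
  cond_num (W *m S *m U^T) <= p * f * cond_num L.
Proof.
move=> f0 Uf; rewrite (csvd_cond_num csvdL) (csvd_cond_num csvdC) -/Smax -/Smin.
have [_ _ [_ SCpos] _ _] := csvdC.
rewrite ler_pdivrMr // mulrA mulrAC ler_pdivlMr //.
apply: le_trans (_ : f * Smax * Smin <= _).
  by rewrite ler_wpM2r ?(ltW Smin_gt0) // csvd_sub_sing_val_le.
have -> : p * f * Smax * SC ord_max ord_max = f * Smax * (p * SC ord_max ord_max) by ring.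
by rewrite ler_wpM2l ?csvd_sub_sing_val_ge // mulr_ge0 // ltW.
Qed.

End ColumnSubmatrixConditioning.

End SingularValues.

(** * Incoherence of sampled columns *)

Section SampledColumns.
Context {R : realType} {m n r : nat}.

Definition row_vec (V : 'M[R]_(n, r)) (j : 'I_n) : 'cV[R]_r := V^T *m evec R j.

Lemma row_vecE (V : 'M[R]_(n, r)) j a : row_vec V j a 0 = V j a.
Proof. by rewrite /row_vec /evec -colE !mxE. Qed.

Lemma gram_row_vec (V : 'M[R]_(n, r)) : gram (row_vec V) [set: 'I_n] = V^T *m V.
Proof.
apply/matrixP => a c; rewrite /gram summxE [RHS]mxE.
apply: eq_big => j; rewrite ?inE // => _.
by rewrite mxE big_ord1 [in X in _ * X]mxE !row_vecE mxE.
Qed.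

Lemma rowsubset_evec (V : 'M[R]_(n, r)) (J : {set 'I_n}) (i : 'I_#|J|) :
  (rowsubset V J)^T *m evec R i = row_vec V (enum_val i).
Proof. by apply/colP => a; rewrite row_vecE /evec -colE !mxE. Qed.

Lemma colsubset_mul (W : 'M[R]_(m, r)) (V : 'M[R]_(n, r)) J :
  colsubset (W *m V^T) J = W *m (rowsubset V J)^T.
Proof.
by apply/matrixP => i j; rewrite !mxE; apply: eq_bigr => a _; rewrite !mxE.
Qed.

Lemma dotv_rowsubset (V : 'M[R]_(n, r)) J x :
  dotv (rowsubset V J *m x) (rowsubset V J *m x) = dotv x (gram (row_vec V) J *m x).
Proof.
rewrite dotv_gram dotvE [RHS]big_enum_val; apply: eq_bigr => i _.
rewrite -expr2; congr (_ ^+ 2); rewrite dotvE mxE.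
by apply: eq_bigr => a _; rewrite row_vecE mxE.
Qed.

(** A Frobenius-type bound, Cauchy-Schwarz on each row; it is the source of the factor
    [Num.sqrt (mu2 * r%:R)] in the bound on the condition number. *)
Lemma vnorm_rowsubset_le (V : 'M[R]_(n, r)) J b x :
  (forall j, dotv (row_vec V j) (row_vec V j) <= b) ->
  vnorm (rowsubset V J *m x) <= Num.sqrt (#|J|%:R * b) * vnorm x.
Proof.
move=> vb; rewrite [X in _ * X]vnormE -sqrtrM; last first.
  rewrite mulr_natl -sumr_const; apply: sumr_ge0 => j _.
  exact: le_trans (dotvv_ge0 _) (vb j).
rewrite vnormE; apply: ler_wsqrtr; rewrite dotv_rowsubset dotv_gram -mulrA mulr_natl.
rewrite -sumr_const; apply: ler_sum => j _; apply: le_trans (dotv_CauchySchwarz _ _) _.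
by rewrite ler_wpM2r ?dotvv_ge0.
Qed.

Lemma not_ill_conditioned (v : 'I_n -> 'cV[R]_r) lambda (J : {set 'I_n}) :
  J \notin ill_conditioned v lambda #|J| ->
  forall x, lambda * dotv x x <= dotv x (gram v J *m x).
Proof.
rewrite inE eqxx /= => /asboolPn nill x; rewrite leNgt; apply/negP => xl.
have [x0|x0] := eqVneq x 0.
  by move: xl; rewrite x0 mulmx0 /dotv mulmx0 mxE mulr0 ltxx.
have xx : 0 < dotv x x by rewrite dotvv_gt0.
apply: nill; exists ((vnorm x)^-1 *: x).
  by rewrite dotvZl dotvZr mulrA -expr2 exprVn sqr_vnorm mulVf // gt_eqF.
rewrite -scalemxAr dotvZl dotvZr mulrA -expr2 exprVn sqr_vnorm mulrC.
by rewrite ltr_pdivrMr.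
Qed.

End SampledColumns.

Section Incoherence.
Context {R : realType}.

(** Shaped like the inner conclusion of the theorem, so that the two are convertible. *)
Definition csvd_incoherent m q s (r : nat) (C : 'M[R]_(m, q)) (WC : 'M[R]_(m, s))
    (VC : 'M[R]_(q, s)) (mu1 mu2 beta kappa : R) : Prop :=
  [/\ forall i : 'I_q, vnorm (VC^T *m evec R i) <=
        beta * kappa * Num.sqrt (mu2 * r%:R / q%:R),
      cond_num C <= beta * Num.sqrt (mu2 * r%:R) * kappa,
      forall i : 'I_m, vnorm (WC^T *m evec R i) <= Num.sqrt (mu1 * r%:R / m%:R)
    & forall i : 'I_q, vnorm (VC^T *m evec R i) <=
        Num.sqrt (beta ^+ 2 * kappa ^+ 2 * mu2 * r%:R / q%:R)].

Lemma cond_num_ge0 m n s (A : 'M[R]_(m, n)) (W : 'M[R]_(m, s)) S (V : 'M[R]_(n, s)) :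
  is_csvd A W S V -> 0 <= cond_num A.
Proof.
case: s W S V => [|s] W S V csvdA; first by rewrite (csvd0_cond_num csvdA).
rewrite (csvd_cond_num csvdA).
by have [_ _ [_ Spos] _ _] := csvdA; rewrite divr_ge0 // ltW.
Qed.

Lemma csvd0_incoherent m q r (C : 'M[R]_(m, q)) (WC : 'M[R]_(m, 0)) SC
    (VC : 'M[R]_(q, 0)) mu1 mu2 beta kappa :
  is_csvd C WC SC VC -> 0 <= beta -> 0 <= kappa ->
  csvd_incoherent r C WC VC mu1 mu2 beta kappa.
Proof.
move=> csvdC b0 k0.
have v0 p (V : 'M[R]_(p, 0)) x : vnorm (V^T *m x) = 0.
  by rewrite (_ : V^T *m x = 0) ?vnorm0 //; apply/colP => -[].
rewrite /csvd_incoherent (csvd0_cond_num csvdC).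
by split=> [i||i|i]; rewrite ?v0 ?sqrtr_ge0 // !mulr_ge0 ?sqrtr_ge0.
Qed.

Lemma csvd_incoherent_sub m n r s (L : 'M[R]_(m, n)) (W : 'M[R]_(m, r.+1)) S
    (V : 'M[R]_(n, r.+1)) (J : {set 'I_n}) WC SC (VC : 'M[R]_(#|J|, s)) mu1 mu2 p :
  is_csvd L W S V -> (0 < #|J|)%N -> 0 <= mu2 -> 0 <= p ->
  (forall i : 'I_m, vnorm (W^T *m evec R i) <= Num.sqrt (mu1 * r.+1%:R / m%:R)) ->
  (forall i : 'I_n, vnorm (V^T *m evec R i) <= Num.sqrt (mu2 * r.+1%:R / n%:R)) ->
  (forall x, vnorm x <= p * vnorm (rowsubset V J *m x)) ->
  is_csvd (colsubset L J) WC SC VC ->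
  csvd_incoherent r.+1 (colsubset L J) WC VC mu1 mu2
    (Num.sqrt (#|J|%:R / n%:R) * p) (cond_num L).
Proof.
move=> csvdL J0 mu0 p0 hW hV Vp csvdC.
have k0 := cond_num_ge0 csvdL.
have b0 : 0 <= Num.sqrt (#|J|%:R / n%:R) * p by rewrite mulr_ge0 ?sqrtr_ge0.
(* A zero matrix [C] has an empty decomposition; its condition number is then 0 by the default value
   of the supremum. *)
case: s WC SC VC csvdC => [|s] WC SC VC csvdC; first exact: csvd0_incoherent csvdC b0 k0.
have LE : colsubset L J = W *m S *m (rowsubset V J)^T.
  by have [_ _ _ _ ->] := csvdL; rewrite colsubset_mul.
rewrite LE in csvdC *.
have nr0 : 0 < n%:R :> R.
  by rewrite ltr0n (leq_trans J0) // -[X in (_ <= X)%N](card_ord n) max_card.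
have Jr0 : 0 < #|J|%:R :> R by rewrite ltr0n.
set w := mu2 * r.+1%:R; have w0 : 0 <= w by rewrite mulr_ge0.
have right i : vnorm (VC^T *m evec R i) <=
    Num.sqrt (#|J|%:R / n%:R) * p * cond_num L * Num.sqrt (w / #|J|%:R).
  apply: le_trans (csvd_sub_right_vnorm csvdL csvdC Vp _ p0) _.
  rewrite rowsubset_evec.
  have -> : Num.sqrt (#|J|%:R / n%:R) * p * cond_num L * Num.sqrt (w / #|J|%:R) =
      p * cond_num L * (Num.sqrt (#|J|%:R / n%:R) * Num.sqrt (w / #|J|%:R)) by ring.
  rewrite -sqrtrM ?divr_ge0 //.
  have -> : #|J|%:R / n%:R * (w / #|J|%:R) = w / n%:R by field; rewrite !gt_eqF.
  by rewrite ler_wpM2l ?(mulr_ge0 p0 k0) //; exact: hV.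
split=> // [|i|i].
- have f0 : 0 <= Num.sqrt (#|J|%:R * (w / n%:R)) by rewrite sqrtr_ge0.
  apply: le_trans (csvd_sub_cond_num csvdL csvdC Vp f0 _) _ => [x|].
    apply: vnorm_rowsubset_le => j; rewrite -sqr_vnorm.
    have wn0 : 0 <= w / n%:R by rewrite divr_ge0.
    by rewrite -[leRHS](sqr_sqrtr wn0) ler_sqr ?nnegrE ?vnorm_ge0 ?sqrtr_ge0 ?hV.
  have -> : Num.sqrt (#|J|%:R * (w / n%:R)) = Num.sqrt (#|J|%:R / n%:R) * Num.sqrt w.
    by rewrite -sqrtrM ?divr_ge0 // mulrA mulrAC.
  by rewrite le_eqVlt; apply/orP; left; apply/eqP; rewrite -/w; ring.
- exact: le_trans (csvd_sub_left_vnorm csvdL csvdC _) (hW i).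
- apply: le_trans (right i) _.
  set B := _ * p in b0 *.
  have -> : B ^+ 2 * cond_num L ^+ 2 * mu2 * r.+1%:R / #|J|%:R =
      (B * cond_num L) ^+ 2 * (w / #|J|%:R) by rewrite /w; ring.
  by rewrite [leRHS]sqrtrM ?sqr_ge0 // sqrtr_sqr ger0_norm // mulr_ge0.
Qed.

End Incoherence.

Theorem theorem3p5 (R : realType) (m n r k : nat) (L : 'M[R]_(m, n))
  (WL : 'M[R]_(m, r)) (SL : 'M[R]_r) (VL : 'M[R]_(n, r))
  (mu1 mu2 gamma delta : R) :
  \rank L = r ->
  is_csvd L WL SL VL ->
  (forall i : 'I_m, vnorm (WL^T *m evec R i) <= Num.sqrt (mu1 * r%:R / m%:R)) ->
  (forall i : 'I_n, vnorm (VL^T *m evec R i) <= Num.sqrt (mu2 * r%:R / n%:R)) ->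
  0 < gamma -> (k <= n)%N -> gamma * mu2 * r%:R <= k%:R ->
  0 <= delta < 1 ->
  let beta (J : {set 'I_n}) :=
    Num.sqrt (#|J|%:R / n%:R) * spec_norm (mp_pinv (rowsubset VL J)) in
  let good (J : {set 'I_n}) : Prop :=
    [/\ beta J <= 1 / Num.sqrt (1 - delta)
      & forall (s : nat) (WC : 'M[R]_(m, s)) (SC : 'M[R]_s) (VC : 'M[R]_(#|J|, s)),
          is_csvd (colsubset L J) WC SC VC ->
          [/\ forall i : 'I_#|J|, vnorm (VC^T *m evec R i)
                 <= beta J * cond_num L * Num.sqrt (mu2 * r%:R / #|J|%:R),
              cond_num (colsubset L J) <= beta J * Num.sqrt (mu2 * r%:R) * cond_num L,
              forall i : 'I_m, vnorm (WC^T *m evec R i) <= Num.sqrt (mu1 * r%:R / m%:R)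
            & forall i : 'I_#|J|, vnorm (VC^T *m evec R i)
                 <= Num.sqrt (beta J ^+ 2 * cond_num L ^+ 2 * mu2 * r%:R / #|J|%:R)]] in
  1 - r%:R / expR (gamma * (delta + (1 - delta) * ln (1 - delta)))
    <= #|[set J : {set 'I_n} | (#|J| == k) && `[< good J >]]|%:R / 'C(n, k)%:R.
Proof.
move=> _ csvdL hW hV g0 kn gk /andP[d0 d1].
pose beta (J : {set 'I_n}) :=
  Num.sqrt (#|J|%:R / n%:R) * spec_norm (mp_pinv (rowsubset VL J)).
pose good (J : {set 'I_n}) : Prop := beta J <= 1 / Num.sqrt (1 - delta) /\
  forall s (WC : 'M[R]_(m, s)) SC VC, is_csvd (colsubset L J) WC SC VC ->
  csvd_incoherent r (colsubset L J) WC VC mu1 mu2 (beta J) (cond_num L).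
change (1 - r%:R / expR (gamma * (delta + (1 - delta) * ln (1 - delta))) <=
  #|[set J : {set 'I_n} | (#|J| == k) && `[< good J >]]|%:R / 'C(n, k)%:R).
have C0 : 0 < 'C(n, k)%:R :> R by rewrite ltr0n bin_gt0.
have d10 : 0 < 1 - delta by rewrite subr_gt0.
have kappa0 := cond_num_ge0 csvdL.
have beta0 J : 0 <= beta J by rewrite mulr_ge0 ?sqrtr_ge0 ?spec_norm_ge0.
rewrite ler_pdivlMr //.
pose allk := [set J : {set 'I_n} | #|J| == k].
have card_allk : #|allk| = 'C(n, k) by rewrite card_draws card_ord.
case: r WL SL VL csvdL hW hV gk @beta @good beta0 =>
  [|r'] WL SL VL csvdL hW hV gk beta good beta0.
  (* For rank 0 the claimed probability is 1, so every subset of size [k] has to be good. *)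
  rewrite mul0r subr0 mul1r -card_allk ler_nat; apply/subset_leq_card/fintype.subsetP => J.
  rewrite !inE => -> /=; apply/asboolP; split=> [|s WC SC VC csvdC].
    have -> : beta J = 0.
      rewrite /beta (_ : spec_norm _ = 0) ?mulr0 //; apply/eqP.
      rewrite eq_le spec_norm_ge0 andbT; apply: spec_norm_le => // y.
      by rewrite mul0r (_ : _ *m y = 0) ?vnorm0 //; apply/colP => -[].
    by rewrite divr_ge0 // sqrtr_ge0.
  case: s WC SC VC csvdC => [|s] WC SC VC csvdC.
    exact: csvd0_incoherent csvdC (beta0 J) kappa0.
  have LE : colsubset L J = WL *m SL *m (rowsubset VL J)^T.
    by have [_ _ _ _ ->] := csvdL; rewrite colsubset_mul.
  (* A decomposition of [C] with a singular value would embed a nonzero space isometrically into a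
     space of dimension 0. *)
  rewrite LE in csvdC; have [Q [QQ _ _]] := csvd_factor csvdL csvdC.
  have := congr1 (fun M : 'M[R]_s.+1 => M ord0 ord0) QQ.
  by rewrite /= mxE big_ord0 mxE eqxx => /esym/eqP; rewrite oner_eq0.
pose v := row_vec VL; pose b := mu2 * r'.+1%:R / n%:R.
have frame : gram v [set: 'I_n] = 1%:M.
  by rewrite gram_row_vec; have [_ -> _ _ _] := csvdL.
(* Otherwise the incoherence bound would make every row of [VL] vanish, contradicting the frame
   identity. *)
have b0 : 0 < b.
  rewrite ltNge; apply/negP => b_le0.
  have v0 j : v j = 0.
    apply/eqP; rewrite -[_ == _]negbK -vnorm_gt0 -leNgt.
    by apply: le_trans (hV j) _; rewrite ler0_sqrtr.
  have := congr1 (fun M : 'M[R]_r'.+1 => M ord0 ord0) frame.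
  rewrite /= /gram big1 => [|j _]; last by rewrite v0 mul0mx.
  by rewrite !mxE => /esym/eqP; rewrite oner_eq0.
have n0 : (0 < n)%N.
  rewrite lt0n; apply/negP => /eqP n0; move: b0.
  by rewrite /b n0 invr0 mulr0 ltxx.
have nr0 : 0 < n%:R :> R by rewrite ltr0n.
have vb j : dotv (v j) (v j) <= b.
  rewrite -sqr_vnorm -(sqr_sqrtr (ltW b0)) ler_sqr ?nnegrE ?vnorm_ge0 ?sqrtr_ge0 //.
  exact: hV.
have bE : n%:R * b = mu2 * r'.+1%:R by rewrite /b mulrC divfK ?gt_eqF.
have mu20 : 0 < mu2.
  by have := mulr_gt0 nr0 b0; rewrite bE pmulr_lgt0.
have k0 : (0 < k)%N.
  rewrite -(ltr0n R); apply: lt_le_trans gk.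
  by rewrite -mulrA mulr_gt0 // mulr_gt0.
(* For [delta = 0] the tail bound does not apply, as its [theta] would be 0, but the claimed
   probability is then at most [1 - r], hence not positive. *)
have [d00|dpos] := eqVneq delta 0.
  rewrite d00 subr0 ln1 mulr0 addr0 mulr0 expR0 divr1.
  by apply: le_trans (ler0n _ _); rewrite pmulr_lle0 // subr_le0.
have dd : 0 < delta < 1 by rewrite d1 lt_def dpos d0.
set lambda := (1 - delta) * (k%:R / n%:R).
have l0 : 0 < lambda by rewrite mulr_gt0 // divr_gt0 // ltr0n.
have gk' : gamma * (n%:R * b) <= k%:R by rewrite bE mulrA.
have := card_ill_conditioned n0 (ltn0Sn r') frame b0 vb dd kn gk'.
rewrite -/lambda expRN; set e := expR _ => ill_le.
rewrite mulrBl mul1r lerBlDr; set G := [set J | _].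
(* Union bound: every subset of size [k] is good or ill-conditioned. *)
apply: le_trans (_ : (#|G| + #|ill_conditioned v lambda k|)%:R <= _); last first.
  by rewrite natrD lerD2l; apply: le_trans ill_le _; rewrite -mulrA mulrC.
rewrite ler_nat -card_allk.
apply: leq_trans (_ : #|G :|: ill_conditioned v lambda k| <= _)%N; last first.
  by rewrite cardsU leq_subr.
apply/subset_leq_card/fintype.subsetP => J; rewrite inE => /eqP cJ.
rewrite finset.in_setU orbC; have [//|nill /=] := boolP (J \in ill_conditioned _ _ _).
rewrite -cJ in nill; have well := not_ill_conditioned nill.
rewrite inE cJ eqxx /=; apply/asboolP.
have Al x : lambda * dotv x x <= dotv (rowsubset VL J *m x) (rowsubset VL J *m x).
  by rewrite dotv_rowsubset.
split=> [|s WC SC VC csvdC]; last first.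
  apply: csvd_incoherent_sub csvdL _ (ltW mu20) (spec_norm_ge0 _) hW hV _ csvdC.
    by rewrite cJ.
  exact: vnorm_le_mp_pinv l0 Al.
(* The factor [k / n] inside [lambda] cancels the normalization of [beta], leaving the inverse
   square root of [1 - delta]. *)
apply: le_trans (ler_wpM2l (sqrtr_ge0 _) (spec_norm_mp_pinv l0 Al)) _.
rewrite cJ /lambda [Num.sqrt ((1 - delta) * _)]sqrtrM ?(ltW d10) //.
rewrite invfM mulrCA divff ?mulr1 ?div1r //.
by rewrite gt_eqF // sqrtr_gt0 divr_gt0 // ltr0n.
Qed.
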